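(* $\mathcal{B}_{\aleph_0}\cap\left(\frac{1+\sqrt{5}}{2}, q_3\right]=\{q_1,q_2,q_3\}$.
   Context: For $q\in(1,2)$ let $I_q=[0,\frac{1}{q-1}]$. A $q$-expansion of $x\in I_q$ is a sequence $(\delta_i)_{i=1}^\infty\in\{0,1\}^{\mathbb{N}}$ with $x=\sum_{i=1}^\infty \delta_i q^{-i}$, and $\Sigma_q(x)$ denotes the set of all $q$-expansions of $x$. Define $\mathcal{B}_{\aleph_0}=\{q\in[\frac{1+\sqrt5}{2},2): \text{there exists } x\in I_q \text{ with } \#\Sigma_q(x)=\aleph_0\}$, where $\#$ denotes cardinality and $\aleph_0$ means countably infinite. The numbers $q_1\approx1.64541$ and $q_2\approx1.65462$ are the positive roots of $x^6-x^4-x^3-2x^2-x-1=0$ and $x^6-2x^4-x^3-1=0$, respectively, and $q_3\approx1.68042$ is the unique root of $x^5-x^4-x^3-x+1=0$ in $(1,2)$. *)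

(* Defs.v *)
From HB Require Import structures.
From mathcomp Require Import all_boot all_order all_algebra.
From mathcomp Require Import all_classical all_reals all_analysis.
From mathcomp Require Import ring lra.

Set Implicit Arguments.
Unset Strict Implicit.
Unset Printing Implicit Defensive.

Import Order.TTheory GRing.Theory Num.Theory.
Import numFieldNormedType.Exports.

Local Open Scope classical_set_scope.
Local Open Scope card_scope.
Local Open Scope ring_scope.

Section Expansions.
Variable R : realType.
Implicit Types (q x : R) (delta : nat -> bool).

Definition golden_ratio : R := (1 + Num.sqrt 5) / 2.

Definition I_ q : set R := `[0, 1 / (q - 1)].

(* Digit sequences are numbered from 0: [delta i] is the digit written
   $\delta_{i+1}$, the coefficient of $q^{-(i+1)}$. *)
Definition q_expansion q x delta : Prop :=
  series (fun i => (delta i)%:R * q ^- i.+1) @ \oo --> x.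

Definition Sigma_ q x : set (nat -> bool) := [set delta | q_expansion q x delta].

Definition B_aleph0 : set R :=
  [set q | golden_ratio <= q < 2 /\
           exists2 x, x \in I_ q & Sigma_ q x #= [set: nat]].

End Expansions.

(* The equations defining $q_1$, $q_2$, $q_3$ have exactly one positive root
   (for $q_3$: exactly one root in $(1,2)$). *)
Section Roots.
Variable R : realType.
Implicit Types x y : R.

Let ltXn n x y : 0 < x -> x < y -> 0 < y ^+ n.+1 - x ^+ n.+1.
Proof. by move=> x0 xy; rewrite subr_gt0 ltrXn2r// ltW. Qed.

Let exists_unique (P : set R) :
  (exists x, P x) -> (forall x y, P x -> P y -> x < y -> False) ->
  exists! x, P x.
Proof.
move=> [x Px] H; exists x; split=> // y Py.
by have [/(H _ _ Px Py)|/(H _ _ Py Px)|] := ltgtP x y.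
Qed.

Lemma q1_exists_unique : exists! x : R,
  0 < x /\ x ^+ 6 - x ^+ 4 - x ^+ 3 - 2 * x ^+ 2 - x - 1 = 0.
Proof.
apply: exists_unique.
  have [||x] := @poly_ivt R ('X^6 - 'X^4 - 'X^3 - 2%:P * 'X^2 - 'X - 1) 1 2.
  - by lra.
  - by rewrite !hornerE /=; lra.
  move=> /andP[x1 _]; rewrite rootE !hornerE /= => /eqP px.
  by exists x; split; [lra | rewrite -[RHS]px; ring].
move=> x y [x0 px] [y0 py] xy.
have X n := ltXn n x0 xy.
have Y n : 0 < x ^+ n * y ^+ n by rewrite mulr_gt0 ?exprn_gt0.
have : x ^+ 6 * (y ^+ 6 - y ^+ 4 - y ^+ 3 - 2 * y ^+ 2 - y - 1)
     - y ^+ 6 * (x ^+ 6 - x ^+ 4 - x ^+ 3 - 2 * x ^+ 2 - x - 1) =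
  (x ^+ 4 * y ^+ 4) * (y ^+ 2 - x ^+ 2) + (x ^+ 3 * y ^+ 3) * (y ^+ 3 - x ^+ 3)
  + 2 * ((x ^+ 2 * y ^+ 2) * (y ^+ 4 - x ^+ 4))
  + (x ^+ 1 * y ^+ 1) * (y ^+ 5 - x ^+ 5) + (y ^+ 6 - x ^+ 6) by ring.
rewrite px py.
have := mulr_gt0 (Y 4) (X 1); have := mulr_gt0 (Y 3) (X 2).
have := mulr_gt0 (Y 2) (X 3); have := mulr_gt0 (Y 1) (X 4); have := X 5.
by lra.
Qed.

Lemma q2_exists_unique : exists! x : R,
  0 < x /\ x ^+ 6 - 2 * x ^+ 4 - x ^+ 3 - 1 = 0.
Proof.
apply: exists_unique.
  have [||x] := @poly_ivt R ('X^6 - 2%:P * 'X^4 - 'X^3 - 1) 1 2.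
  - by lra.
  - by rewrite !hornerE /=; lra.
  move=> /andP[x1 _]; rewrite rootE !hornerE /= => /eqP px.
  by exists x; split; [lra | rewrite -[RHS]px; ring].
move=> x y [x0 px] [y0 py] xy.
have X n := ltXn n x0 xy.
have Y n : 0 < x ^+ n * y ^+ n by rewrite mulr_gt0 ?exprn_gt0.
have : x ^+ 6 * (y ^+ 6 - 2 * y ^+ 4 - y ^+ 3 - 1)
     - y ^+ 6 * (x ^+ 6 - 2 * x ^+ 4 - x ^+ 3 - 1) =
  2 * ((x ^+ 4 * y ^+ 4) * (y ^+ 2 - x ^+ 2))
  + (x ^+ 3 * y ^+ 3) * (y ^+ 3 - x ^+ 3) + (y ^+ 6 - x ^+ 6) by ring.
rewrite px py.
have := mulr_gt0 (Y 4) (X 1); have := mulr_gt0 (Y 3) (X 2); have := X 5.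
by lra.
Qed.

Lemma q3_exists_unique : exists! x : R,
  1 < x < 2 /\ x ^+ 5 - x ^+ 4 - x ^+ 3 - x + 1 = 0.
Proof.
apply: exists_unique.
  have [||x] := @poly_ivt R ('X^5 - 'X^4 - 'X^3 - 'X + 1) 1 2.
  - by lra.
  - by rewrite !hornerE /=; lra.
  move=> /andP[x1 x2]; rewrite rootE !hornerE /= => /eqP px.
  exists x; split=> //; rewrite !lt_neqAle x1 x2 !andbT.
  apply/andP; split; apply/eqP => xE; move: px; first by rewrite -xE; lra.
  by rewrite xE; lra.
move=> x y [/andP[x1 _] px] [/andP[y1 _] py] xy.
have [s0 st] : 0 < x - 1 /\ x - 1 < y - 1 by split; lra.
have X n := ltXn n s0 st.
have Y : 0 < (x - 1) * (y - 1) by rewrite mulr_gt0; lra.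
have : (x - 1) * (y ^+ 5 - y ^+ 4 - y ^+ 3 - y + 1)
     - (y - 1) * (x ^+ 5 - x ^+ 4 - x ^+ 3 - x + 1) =
  (x - 1) * (y - 1) * (((y - 1) ^+ 4 - (x - 1) ^+ 4)
    + 4 * ((y - 1) ^+ 3 - (x - 1) ^+ 3) + 5 * ((y - 1) ^+ 2 - (x - 1) ^+ 2)
    + ((y - 1) ^+ 1 - (x - 1) ^+ 1)) + (y - x) by ring.
rewrite px py.
have := mulr_gt0 Y (X 3); have := mulr_gt0 Y (X 2).
have := mulr_gt0 Y (X 1); have := mulr_gt0 Y (X 0).
by lra.
Qed.

End Roots.

Arguments golden_ratio {R}.
Arguments B_aleph0 {R}.

(* Main.v *)
(* The expansions of x are the words of digits along which the maps
   y |-> q y - b keep the orbit of x inside [0, 1 / (q - 1)]. If they are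
   countably but infinitely many, a diagonal argument gives a point of the orbit
   with infinitely many expansions from which no branching leaves infinitely
   many expansions on both sides. For golden ratio < q < q3, a point with
   finitely many expansions has at most one, and the points of
   [0, 1 / (q - 1) - 1] with exactly one are 0 and the values of 0^k (10)^oo,
   k >= 2. Hence, up to the reflection x |-> 1 / (q - 1) - x, the distinguished
   path returns for ever to points 1 + u, u being such a value, and each return
   is an algebraic equation in q relating two consecutive exponents k. For
   q < q1, and for q1 < q < q3 with q != q2, comparing these equations shows
   that no infinite chain of returns exists. At q1, q2 and q3 some point 1 + u
   returns to itself, up to reflection, and its expansions are then countably
   many. *)
Require Import Defs.
From HB Require Import structures.
From mathcomp Require Import all_boot all_order all_algebra.
From mathcomp Require Import all_classical all_reals all_analysis.
From mathcomp Require Import ring lra.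

Set Implicit Arguments.
Unset Strict Implicit.
Unset Printing Implicit Defensive.

Import Order.TTheory GRing.Theory Num.Theory.
Import numFieldNormedType.Exports.

Local Open Scope classical_set_scope.
Local Open Scope card_scope.
Local Open Scope ring_scope.

(** * Expansions as words *)

Definition scons (b : bool) (d : nat -> bool) (n : nat) : bool :=
  if n is m.+1 then d m else b.

Lemma scons_eta d : scons (d 0) (fun n => d n.+1) = d.
Proof. by apply/funext => -[]. Qed.

Lemma scons_inj b : injective (scons b).
Proof. by move=> d d' e; apply/funext => n; have := congr1 (@^~ n.+1) e. Qed.

Lemma mkseqSl T (f : nat -> T) n :
  mkseq f n.+1 = f 0%N :: mkseq (fun i => f i.+1) n.
Proof. by rewrite /mkseq /= -[1%N]addn0 iotaDl -map_comp. Qed.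

Section Walks.
Variables (R : realType) (q : R).
Implicit Types (x y : R) (w v : seq bool) (b : bool) (d : nat -> bool).

Definition walk w x : R := foldl (fun y b => q * y - b%:R) x w.
Definition in_I x := 0 <= x <= 1 / (q - 1).

Lemma walk_cat w v x : walk (w ++ v) x = walk v (walk w x).
Proof. exact: foldl_cat. Qed.

Lemma walk_rcons w b x : walk (rcons w b) x = q * walk w x - b%:R.
Proof. by rewrite -cats1 walk_cat. Qed.

Lemma walk_partial_sum d n x : q != 0 ->
  x - \sum_(0 <= i < n) (d i)%:R * q ^- i.+1 = q ^- n * walk (mkseq d n) x.
Proof.
move=> q0; elim: n => [|n IH].
  by rewrite big_geq // expr0 invr1 mul1r subr0.
rewrite mkseqS walk_rcons big_nat_recr // opprD addrA IH exprS /=.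
by field; rewrite q0 expf_neq0.
Qed.

Hypothesis q_gt1 : 1 < q.

Let q_gt0 : 0 < q. Proof. by move: q_gt1; lra. Qed.
Let q_neq0 : q != 0. Proof. by rewrite gt_eqF. Qed.
Let L := 1 / (q - 1).
Let LE : q * L = L + 1.
Proof. by rewrite /L; field; apply/eqP; move: q_gt1; lra. Qed.
Let L_gt0 : 0 < L. Proof. by rewrite divr_gt0 // subr_gt0. Qed.

Lemma in_I_preimage x b : in_I (q * x - b%:R) -> in_I x.
Proof.
rewrite /in_I -/L => /andP[h0 h1].
have b0 : 0 <= b%:R :> R by rewrite ler0n.
have b1 : b%:R <= 1 :> R by case: b {h0 h1 b0} => /=.
apply/andP; split; first by rewrite -(pmulr_rge0 _ q_gt0); lra.
by rewrite -(ler_pM2l q_gt0) LE; lra.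
Qed.

(** Both digit maps expand away from the interval: an orbit that leaves it never comes back. *)
Lemma in_I_walk w x : in_I (walk w x) -> in_I x.
Proof.
elim/last_ind: w => // w b IH; rewrite walk_rcons => /in_I_preimage.
exact: IH.
Qed.

Lemma digit_series_le d n : \sum_(0 <= i < n) (d i)%:R * q ^- i.+1 <= L.
Proof.
(* Subtracting the tail of ones, [L * q ^- n], makes the induction close. *)
suff : \sum_(0 <= i < n) (d i)%:R * q ^- i.+1 <= L - L * q ^- n.
  move=> /le_trans; apply; rewrite gerBl mulr_ge0 ?ltW //.
  by rewrite invr_gt0 exprn_gt0.
elim: n => [|n IH]; first by rewrite big_geq // expr0 invr1 mulr1 subrr.
rewrite big_nat_recr //=; apply: (le_trans (lerD IH (lexx _))).
have t0 : 0 <= q ^- n.+1 by rewrite invr_ge0 exprn_ge0 // ltW.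
have -> : q ^- n = q * q ^- n.+1.
  by rewrite exprS invfM mulrA mulfV // mul1r.
rewrite mulrA [L * q]mulrC LE.
have : (d n)%:R * q ^- n.+1 <= q ^- n.+1 by case: (d n) => /=; lra.
by lra.
Qed.

(** The walk is the remainder after [n] digits, magnified by [q ^+ n]. For an expansion this
    remainder lies between 0 and the tail of ones; conversely a bounded walk makes it tend to 0. *)
Lemma Sigma_walk x d :
  Sigma_ q x d <-> forall n, in_I (walk (mkseq d n) x).
Proof.
set u := series (fun i => (d i)%:R * q ^- i.+1).
split => [xd n|xd].
  have pn : 0 < q ^+ n by rewrite exprn_gt0.
  have -> : walk (mkseq d n) x = q ^+ n * (x - u n).
    by rewrite walk_partial_sum // mulrA mulfV ?mul1r // gt_eqF.
  have cu : cvgn u by apply/cvg_ex; exists x.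
  have ux : limn u = x by apply/cvg_lim.
  have und : nondecreasing_seq u.
    apply/nondecreasing_seqP => k; rewrite /u /series /= big_nat_recr //=.
    by rewrite lerDl mulr_ge0 ?ler0n // invr_ge0 exprn_ge0 // ltW.
  have le1 : u n <= x by rewrite -ux; exact: nondecreasing_cvgn_le.
  apply/andP; split; first by rewrite mulr_ge0 ?subr_ge0 // ltW.
  rewrite -ler_pdivlMl // lerBlDl -ux.
  apply: limr_le => //; exists n => // m /= nm.
  rewrite /u /series /= (big_cat_nat _ (n := n)) //= lerD2l.
  rewrite -{1}[n]add0n big_addn.
  have -> : \sum_(0 <= i < m - n) (d (i + n)%N)%:R / q ^+ (i + n).+1 =
      q ^- n * \sum_(0 <= i < m - n) (d (i + n)%N)%:R / q ^+ i.+1.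
    rewrite mulr_sumr; apply: eq_bigr => i _.
    by rewrite -addSn exprD invfM [q ^- i.+1 * _]mulrC mulrCA mulrA.
  rewrite ler_pM2l ?invr_gt0 //.
  exact: (digit_series_le (fun i => d (i + n)%N)).
rewrite /Sigma_ /= /q_expansion -/u.
have -> : u = (fun n => x - q ^- n * walk (mkseq d n) x).
  by apply/funext => n; rewrite -walk_partial_sum // opprB addrC subrK.
rewrite -[X in _ --> X]subr0; apply: cvgB; first exact: cvg_cst.
have q1 : `|q^-1| < 1 by rewrite gtr0_norm ?invr_gt0 // invf_lt1.
have c0 : (fun n => L * q ^- n) @ \oo --> (0 : R).
  rewrite -[X in _ --> X](mulr0 L); apply: cvgM; first exact: cvg_cst.
  under eq_fun do rewrite -exprVn.
  exact: cvg_expr.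
apply: (squeeze_cvgr _ (cvg_cst 0) c0); near=> n.
have /andP[a0 a1] := xd n.
have t0 : 0 < q ^- n by rewrite invr_gt0 exprn_gt0.
by apply/andP; split; [rewrite mulr_ge0 // ltW | rewrite mulrC ler_pM2r].
Unshelve. all: by end_near.
Qed.

Lemma Sigma_in_I x d : Sigma_ q x d -> in_I x.
Proof. by move=> /Sigma_walk /(_ 0%N). Qed.

Lemma Sigma_scons b d x :
  Sigma_ q x (scons b d) <-> Sigma_ q (q * x - b%:R) d.
Proof.
split=> /Sigma_walk H; apply/Sigma_walk => n.
  by have := H n.+1; rewrite mkseqSl.
case: n => [|n]; last by rewrite mkseqSl; exact: H.
by have := H 0%N; exact: in_I_preimage.
Qed.

Lemma Sigma_split x : Sigma_ q x =
  scons false @` Sigma_ q (q * x - false%:R) `|`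
  scons true @` Sigma_ q (q * x - true%:R).
Proof.
apply/seteqP; split => [d|d [] [d' xd' <-]]; last 2 first.
- exact/Sigma_scons.
- exact/Sigma_scons.
move=> xd; case E: (d 0%N); [right|left]; exists (fun n => d n.+1).
- by rewrite -E; apply/Sigma_scons; rewrite scons_eta.
- by rewrite -[in RHS](scons_eta d) E.
- by rewrite -E; apply/Sigma_scons; rewrite scons_eta.
- by rewrite -[in RHS](scons_eta d) E.
Qed.

Hypothesis q_lt2 : q < 2.

(** Greedy digits keep the orbit in the interval: after a digit 0 the point is below 1, hence below
    [L], because [q < 2]. *)
Lemma Sigma_nonempty x : in_I x -> Sigma_ q x !=set0.
Proof.
move=> Ix; pose g y := q * y - (1 <= q * y)%R%:R.
exists (fun n => 1 <= q * iter n g x); apply/Sigma_walk => n.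
have -> : walk (mkseq (fun n => 1 <= q * iter n g x) n) x = iter n g x.
  by elim: n => // n IH; rewrite mkseqS walk_rcons IH iterS.
elim: n => // n IH; rewrite iterS; move: (iter n g x) IH => y.
rewrite /in_I -/L => /andP[y0 y1].
have L1 : 1 < L by rewrite /L ltr_pdivlMr; move: q_gt1 q_lt2; lra.
have qy0 : 0 <= q * y by rewrite mulr_ge0 // ltW.
have qy1 : q * y <= q * L by rewrite ler_pM2l.
rewrite /g /in_I -/L.
by case: (leP 1 (q * y)) => ? /=; apply/andP; split; move: LE; lra.
Qed.

End Walks.

(** * Branching of expansions *)

Section Branching.
Variables (R : realType) (q : R).
Hypotheses (q_gt1 : 1 < q) (q_lt2 : q < 2).
Implicit Types (x y : R) (w : seq bool) (b : bool) (d : nat -> bool).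

Definition in_switch y := 1 <= q * y <= 1 / (q - 1).
(** Words leaving the interval may be included: they never come back to it, hence never meet a
    switch point. *)
Definition switch_free x := forall w, ~ in_switch (walk q w x).

Lemma in_switchP y :
  in_switch y <-> in_I q (q * y - false%:R) /\ in_I q (q * y - true%:R).
Proof.
rewrite /in_switch /in_I /=; split=> [/andP[? ?]|[/andP[? ?] /andP[? ?]]].
  by split; apply/andP; split; move: q_gt1; lra.
by apply/andP; split; lra.
Qed.

Lemma switch_free_walk w x : switch_free x -> switch_free (walk q w x).
Proof. by move=> H v; rewrite -walk_cat; exact: H. Qed.

Lemma switch_free_Sigma x : switch_free x -> is_subset1 (Sigma_ q x).
Proof.
move=> sfx d d' /(Sigma_walk q_gt1) xd /(Sigma_walk q_gt1) xd'.
have E n : mkseq d n = mkseq d' n.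
  elim: n => // n IH; rewrite !mkseqS IH; congr rcons.
  have := xd n.+1; have := xd' n.+1; rewrite !mkseqS !walk_rcons IH.
  have := sfx (mkseq d' n); rewrite in_switchP => nI.
  by case: (d n) (d' n) => [] [] // ? ?; case: nI.
by apply/funext => n; have := E n.+1; rewrite !mkseqS => /rcons_inj[].
Qed.

Lemma switch_free_finite x : switch_free x -> finite_set (Sigma_ q x).
Proof.
move=> /switch_free_Sigma sx.
have [->|/set0P[d xd]] := eqVneq (Sigma_ q x) set0; first exact: finite_set0.
apply: (@sub_finite_set _ _ [set d]); last exact: finite_set1.
by move=> d' xd'; apply: sx.
Qed.

Lemma infinite_child x b : infinite_set (Sigma_ q x) ->
  ~ infinite_set (Sigma_ q (q * x - (~~ b)%:R)) ->
  infinite_set (Sigma_ q (q * x - b%:R)).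
Proof.
move=> ix /contrapT fx fx'; apply: ix; rewrite Sigma_split // finite_setU.
by case: b fx fx' => ? ?; split; apply: finite_image.
Qed.

(** Induction on a bound for the number of expansions. At a switch point both digits extend to an
    expansion, so each branch has strictly fewer; by induction both branches are switch-free, which
    the hypothesis forbids. *)
Lemma finite_switch_free x :
  (forall y, in_switch y -> switch_free (q * y - false%:R) ->
     switch_free (q * y - true%:R) -> False) ->
  finite_set (Sigma_ q x) -> switch_free x.
Proof.
move=> no2.
suff H n y (s : seq (nat -> bool)) : (size s < n)%N ->
    (forall d, Sigma_ q y d -> d \in s) -> switch_free y.
  move=> /finite_seqP[s xs]; apply: (H (size s).+1 x s) => // d xd.
  by have : [set` s] d by rewrite -xs.
elim: n y s => // n IH y s sn ys.
have cover b z (t : seq (nat -> bool)) : (forall d, Sigma_ q z d -> d \in t) ->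
    forall d, Sigma_ q (q * z - b%:R) d ->
      d \in [seq (fun i => e i.+1) | e <- t & e 0%N == b].
  move=> zt d /(Sigma_scons q_gt1)/zt dt; apply/mapP.
  by exists (scons b d); rewrite ?mem_filter ?eqxx.
have walk_cover w : exists2 t : seq (nat -> bool), (size t <= n)%N &
    forall d, Sigma_ q (walk q w y) d -> d \in t.
  elim/last_ind: w => [|w b [t tn wt]]; first by exists s.
  rewrite walk_rcons; exists [seq (fun i => e i.+1) | e <- t & e 0%N == b].
    by rewrite size_map size_filter (leq_trans (count_size _ _)).
  exact: cover.
move=> w sw; have [t tn wt] := walk_cover w.
have /in_switchP[I0 I1] := sw.
have lt b : in_I q (q * walk q w y - (~~ b)%:R) ->
    (count (fun e : nat -> bool => e 0%N == b) t < n)%N.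
  move=> /(Sigma_nonempty q_gt1 q_lt2)[d xd]; apply: leq_trans tn.
  have := cover _ _ _ wt _ xd; move=> /mapP[e]; rewrite mem_filter.
  rewrite -(count_predC (fun e : nat -> bool => e 0%N == b)) => /andP[e0 et] _.
  rewrite -[ltnLHS]addn0 ltn_add2l -has_count; apply/hasP; exists e => //=.
  by rewrite (eqP e0); case: (b).
apply: (no2 _ sw); apply: IH (cover _ _ _ wt).
  by rewrite size_map size_filter; exact: lt.
by rewrite size_map size_filter; exact: lt.
Qed.

(* From such a point there is a single path through points with infinitely many
   expansions. *)
Definition unforked x := infinite_set (Sigma_ q x) /\ forall w,
  ~ (infinite_set (Sigma_ q (walk q (rcons w false) x)) /\
     infinite_set (Sigma_ q (walk q (rcons w true) x))).

Lemma unforked_walk w x :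
  infinite_set (Sigma_ q (walk q w x)) -> unforked x -> unforked (walk q w x).
Proof. by move=> iw [_ H]; split => // v; rewrite -!walk_cat -!rcons_cat. Qed.

(** Only the digit 1 occurs on the forced paths that leave a state; the digit 0 would leave the
    interval there. *)
Inductive forced (x : R) : R -> Prop :=
| forced_refl : forced x x
| forced_right y : 1 / (q - 1) < q * x -> forced (q * x - 1) y -> forced x y.

Lemma unforked_right x :
  unforked x -> 1 / (q - 1) < q * x -> unforked (q * x - 1).
Proof.
move=> ux xL; apply: (unforked_walk (w := [:: true])) (ux).
apply: (infinite_child (b := true)); first by case: ux.
rewrite subr0 => /infinite_setN0[d /(Sigma_in_I q_gt1)/andP[_]].
by rewrite leNgt xL.
Qed.

Lemma unforked_forced x y : forced x y -> unforked x -> unforked y.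
Proof.
by elim=> [{}x|{}x {}y xL _ IH ux]; last exact: IH (unforked_right ux xL).
Qed.

Lemma Sigma_forced x y : forced x y -> exists v : seq bool,
  (forall d, Sigma_ q y d -> Sigma_ q x (foldr scons d v)) /\
  (forall d, Sigma_ q x d -> exists2 d', Sigma_ q y d' & d = foldr scons d' v).
Proof.
elim=> [{}x|{}x {}y xL _ [v [yv xv]]].
  by exists [::]; split => // d; exists d.
exists (true :: v); split => [d /yv ?|d]; first exact/(Sigma_scons q_gt1).
rewrite -(scons_eta d) => xd.
have [d0 d1] : d 0%N = true /\ Sigma_ q (q * x - 1) (fun n => d n.+1).
  case: (d 0%N) xd => /(Sigma_scons q_gt1) xd; first by [].
  move: (Sigma_in_I q_gt1 xd).
  by rewrite /in_I subr0 [q * x <= _]leNgt xL andbF.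
by have [d' yd' E] := xv _ d1; exists d' => //; rewrite d0 E.
Qed.

(* Otherwise every word leading to a point with infinitely many expansions could
   be extended so as to avoid the n-th expansion of [x]: diagonalization. *)
Lemma exists_unforked x : infinite_set (Sigma_ q x) ->
  countable (Sigma_ q x) -> exists w, unforked (walk q w x).
Proof.
move=> ix /countable_injP[f finj]; apply: contrapT => nox.
have fork w : infinite_set (Sigma_ q (walk q w x)) -> exists v, forall b,
    infinite_set (Sigma_ q (walk q (rcons (w ++ v) b) x)).
  move=> iw; apply: contrapT => now; apply: nox; exists w; split => // v.
  move=> [i0 i1]; apply: now; exists v => b.
  by rewrite rcons_cat walk_cat; case: b.
pose P w := infinite_set (Sigma_ q (walk q w x)).
(* One stage of the diagonalization: lengthen the word, keep infinitely many expansions below it,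
   and differ from the expansion numbered [n], if there is one. *)
have step (nw : nat * seq bool) : exists w', P nw.2 -> [/\ P w',
    exists2 v, w' = nw.2 ++ v & (0 < size v)%N &
    forall d, Sigma_ q x d -> f d = nw.1 -> mkseq d (size w') != w'].
  case: nw => n w /=; have [Pw|] := pselect (P w); last by exists w.
  have [v wv] := fork _ Pw.
  have [[d [xd fd]]|nod] := pselect (exists d, Sigma_ q x d /\ f d = n).
    exists (rcons (w ++ v) (~~ d (size (w ++ v)))) => _; split.
    - exact: wv.
    - exists (rcons v (~~ d (size (w ++ v)))).
        by rewrite rcons_cat.
      by rewrite size_rcons.
    move=> d' xd' fd'; have -> : d' = d.
      by apply: finj; rewrite ?inE // fd fd'.
    rewrite size_rcons mkseqS eqseq_rcons negb_and; apply/orP; right.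
    by case: (d _).
  exists (rcons (w ++ v) true) => _; split; first exact: wv.
    by exists (rcons v true); rewrite ?rcons_cat ?size_rcons.
  by move=> d xd fd; case: nod; exists d.
have [g gP] := choice step.
pose u := fix u n := if n is m.+1 then g (m, u m) else [::].
have Pu n : P (u n) by elim: n => // n IH /=; have [] := gP (n, u n) IH.
have uS n : exists2 v, u n.+1 = u n ++ v & (0 < size v)%N.
  by have [] := gP (n, u n) (Pu n).
have uD m n : exists v, u (m + n)%N = u m ++ v.
  elim: n => [|n [v uv]]; first by exists [::]; rewrite addn0 cats0.
  have [v' uv' _] := uS (m + n)%N; exists (v ++ v').
  by rewrite addnS uv' uv catA.
have su n : (n <= size (u n))%N.
  elim: n => // n IH; have [v -> sv] := uS n; rewrite size_cat -addn1.
  exact: leq_add.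
(* The words [u n] are nested and [u n] has at least [n] letters, so letter [i] can be read in
   [u i.+1]. *)
pose d i := nth false (u i.+1) i.
have du n : mkseq d (size (u n)) = u n.
  apply: (@eq_from_nth _ false); rewrite size_mkseq // => i iu.
  rewrite nth_mkseq // /d.
  have [/subnKC ni|/ltnW/subnKC ni] := leqP n i.+1.
    by have [v] := uD n (i.+1 - n)%N; rewrite ni => ->; rewrite nth_cat iu.
  by have [v] := uD i.+1 (n - i.+1)%N; rewrite ni => ->; rewrite nth_cat su.
have xd : Sigma_ q x d.
  apply/(Sigma_walk q_gt1) => n.
  have [v E] : exists v, u n = mkseq d n ++ v.
    exists (drop n (u n)); rewrite -{1}(cat_take_drop n (u n)); congr (_ ++ _).
    by rewrite -{1}du /mkseq -map_take take_iota (minn_idPl (su n)).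
  have [e] := infinite_setN0 (Pu n).
  move=> /(Sigma_in_I q_gt1); rewrite E walk_cat; exact: (in_I_walk q_gt1).
(* The limit [d] extends every [u n], but stage [f d] was chosen to avoid [d]. *)
have [_ _ /(_ d xd erefl)] := gP (f d, u (f d)) (Pu (f d)).
by rewrite -[g _]/(u (f d).+1) du eqxx.
Qed.

End Branching.

(** * Symmetry of the expansions under reflection of the interval *)

Section Reflection.
Variables (R : realType) (q : R).
Hypothesis q_gt1 : 1 < q.
Let L := 1 / (q - 1).
Let LE : q * L = L + 1.
Proof. by rewrite /L; field; apply/eqP; move: q_gt1; lra. Qed.

Lemma walk_reflect w x : walk q (map negb w) (L - x) = L - walk q w x.
Proof.
elim/last_ind: w => // w b IH; rewrite map_rcons !walk_rcons IH mulrBr LE.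
by case: b => /=; ring.
Qed.

Lemma switch_free_reflect x : switch_free q x -> switch_free q (L - x).
Proof.
move=> sx w; rewrite -(mapK negbK w) walk_reflect => /andP[h1 h2].
apply: (sx (map negb w)); move: h1 h2; rewrite mulrBr LE -/L => h1 h2.
by apply/andP; split; rewrite -/L; lra.
Qed.

Lemma Sigma_reflect x d :
  Sigma_ q x d -> Sigma_ q (L - x) (fun n => ~~ d n).
Proof.
move=> /(Sigma_walk q_gt1) xd; apply/(Sigma_walk q_gt1) => n.
have -> : mkseq (fun n => ~~ d n) n = map negb (mkseq d n).
  by rewrite /mkseq -map_comp.
rewrite walk_reflect; have /andP[] := xd n.
by rewrite /in_I -/L => *; apply/andP; split; lra.
Qed.

Lemma infinite_reflect x :
  infinite_set (Sigma_ q x) -> infinite_set (Sigma_ q (L - x)).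
Proof.
move=> ix fx; apply: ix.
apply: sub_finite_set (finite_image (fun d n => ~~ d n) fx) => d xd.
exists (fun n => ~~ d n); first exact: Sigma_reflect.
by apply/funext => n; rewrite negbK.
Qed.

Lemma unforked_reflect x : unforked q x -> unforked q (L - x).
Proof.
move=> [ix nx]; split; first exact: infinite_reflect.
move=> w [h0 h1]; apply: (nx (map negb w)).
have E b : walk q (rcons (map negb w) (~~ b)) x =
    L - walk q (rcons w b) (L - x).
  by rewrite -map_rcons -[in LHS](subKr L x) walk_reflect.
split; first by rewrite -[false]/(~~ true) E; exact: infinite_reflect.
by rewrite -[true]/(~~ false) E; exact: infinite_reflect.
Qed.

End Reflection.

(** * Signs of polynomials between the golden ratio and q3 *)

Section PolynomialSigns.
Variable R : realType.
Implicit Types (q t l h : R).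

Lemma offset_powers_ge l q : 0 <= l -> 8/5 + l <= q ->
  exists t, [/\ q = 8/5 + t, l <= t & forall n, l * t ^+ n.+1 <= t ^+ n.+2].
Proof.
move=> l0 lq; exists (q - 8/5); split; [lra..|move=> n].
by rewrite [_ ^+ n.+2]exprS; apply: ler_wpM2r; rewrite ?exprn_ge0; lra.
Qed.

Lemma offset_powers_le h q : 8/5 <= q <= 8/5 + h ->
  exists t, [/\ q = 8/5 + t, t <= h & forall n, t ^+ n.+2 <= h * t ^+ n.+1].
Proof.
move=> /andP[lq qh]; exists (q - 8/5); split; [lra..|move=> n].
by rewrite [_ ^+ n.+2]exprS; apply: ler_wpM2r; rewrite ?exprn_ge0; lra.
Qed.

(* The polynomials below, apart from their constant terms, have coefficients of
   constant sign when expanded at 8/5; they are therefore monotone beyond 8/5,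
   and bounding [t ^+ n.+1] by [t ^+ n] is enough to compare them with their
   value at the endpoint [8/5 + l] or [8/5 + h]. *)
Ltac by_powers_ge q l :=
  let t := fresh "t" in let tn := fresh "tn" in let E := fresh "E" in
  have [||t [E ? tn]] := @offset_powers_ge l q; [lra | lra | ];
  move: (tn 0%N) (tn 1%N) (tn 2%N) (tn 3%N) (tn 4%N) (tn 5%N) (tn 6%N)
    (tn 7%N) (tn 8%N);
  clear tn; rewrite ?{}E => *; clear dependent q; lra.
Ltac by_powers_le q h :=
  let t := fresh "t" in let tn := fresh "tn" in let E := fresh "E" in
  have [|t [E ? tn]] := @offset_powers_le h q; [apply/andP; split; lra | ];
  move: (tn 0%N) (tn 1%N) (tn 2%N) (tn 3%N) (tn 4%N) (tn 5%N) (tn 6%N)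
    (tn 7%N) (tn 8%N);
  clear tn; rewrite ?{}E => *; clear dependent q; lra.

Definition qe q := q ^+ 2 - q - 1.
Definition poly1 q := q ^+ 6 - q ^+ 4 - q ^+ 3 - 2 * q ^+ 2 - q - 1.
Definition poly2 q := q ^+ 6 - 2 * q ^+ 4 - q ^+ 3 - 1.
Definition poly3 q := q ^+ 5 - q ^+ 4 - q ^+ 3 - q + 1.

(* A state is a point [1 + u], where [u] has the expansion 0^(j+2) (10)^oo; as
   [u = q^-1 ^+ j / (q * (q ^+ 2 - 1))], it is encoded by the exponent [j].
   From the state [j], the digit 1 is forced up to a point [w] with
   [q * w - 1 = state_value q j / (q * (q ^+ 2 - 1))], while
   [1 / (q - 1) - 1 = state_total q / (q * (q ^+ 2 - 1))]. *)
Definition state_value q (j : nat) : R :=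
  match j with
  | 0 => qe q * q * (q ^+ 4 - q ^+ 2 - 1)
  | 1 => qe q * q * (q ^+ 3 - q - 1)
  | i.+2 => qe q * q * (q ^+ 2 - 1) + q^-1 ^+ i
  end.
Definition state_total q : R := (2 - q) * q * (q + 1).

(** With [poly1_gt0], this turns the sign of [poly1] into a numerical bound: its root [q1] lies
    between 329/200 and 823/500. *)
Lemma poly1_lt0 q : 8/5 <= q <= 17/10 -> poly1 q < 0 -> q < 823/500.
Proof.
move=> /andP[a b] h; rewrite ltNge; apply/negP => c; move: h; rewrite /poly1.
by_powers_ge q (23/500:R).
Qed.

Lemma poly1_gt0 q : 8/5 <= q <= 17/10 -> 0 < poly1 q -> 329/200 < q.
Proof.
move=> /andP[a b] h; rewrite ltNge; apply/negP => c; move: h; rewrite /poly1.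
by_powers_le q (9/200:R).
Qed.

Lemma poly3_gt0 q : 1681/1000 <= q <= 2 -> 0 < poly3 q.
Proof.
move=> /andP[a b]; rewrite /poly3.
by_powers_ge q (81/1000:R).
Qed.

Lemma total_gt q : 8/5 <= q <= 1681/1000 -> 7/5 < state_total q.
Proof.
move=> /andP[a b]; rewrite /state_total.
by_powers_le q (81/1000:R).
Qed.

Lemma total_sub0_gt1 q : 809/500 <= q <= 823/500 ->
  1 < state_total q - state_value q 0.
Proof.
move=> /andP[a b]; rewrite /state_total /= /qe.
by_powers_le q (23/500:R).
Qed.

Lemma total_sub1_gt1 q : 809/500 <= q <= 67/40 ->
  1 < state_total q - state_value q 1.
Proof.
move=> /andP[a b]; rewrite /state_total /= /qe.
by_powers_le q (3/40:R).
Qed.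

Lemma value1_lt q : 809/500 <= q <= 1681/1000 -> q * state_value q 1 < 1.
Proof.
move=> /andP[a b]; rewrite /= /qe.
by_powers_le q (81/1000:R).
Qed.

Lemma total_sub0_gt q : 809/500 <= q <= 1681/1000 ->
  1 < q ^+ 2 * (state_total q - state_value q 0).
Proof.
move=> /andP[a b]; rewrite /state_total /= /qe.
by_powers_le q (81/1000:R).
Qed.

Lemma total_sub1_gt q : 809/500 <= q <= 1681/1000 ->
  1 < q * (state_total q - state_value q 1).
Proof.
move=> /andP[a b]; rewrite /state_total /= /qe.
by_powers_le q (81/1000:R).
Qed.

Lemma value1_gt q : 329/200 <= q <= 1681/1000 -> 1 < q ^+ 4 * state_value q 1.
Proof.
move=> /andP[a b]; rewrite /= /qe.
by_powers_ge q (9/200:R).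
Qed.

(** Here and down to [value1_eq3], the equation is a direct or reflected step between two given
    states, cleared of the negative powers of [q]. *)
Lemma value0_eq q : 8/5 <= q <= 17/10 -> q * state_value q 0 = 1 ->
  829/500 < q < 1661/1000.
Proof.
move=> /andP[a b] /=; rewrite /qe => h.
apply/andP; split; rewrite ltNge; apply/negP => c; move: h.
  by_powers_le q (29/500:R).
by_powers_ge q (61/1000:R).
Qed.

Lemma total_sub0_eq q : 8/5 <= q <= 17/10 ->
  q * (state_total q - state_value q 0) = 1 -> 1673/1000 < q < 67/40.
Proof.
move=> /andP[a b] /=; rewrite /state_total /qe => h.
apply/andP; split; rewrite ltNge; apply/negP => c; move: h.
  by_powers_le q (73/1000:R).
by_powers_ge q (3/40:R).
Qed.

Lemma value1_eq2 q : 8/5 <= q <= 17/10 ->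
  q ^+ 2 * state_value q 1 = 1 -> 333/200 < q < 1667/1000.
Proof.
move=> /andP[a b] /=; rewrite /qe => h.
apply/andP; split; rewrite ltNge; apply/negP => c; move: h.
  by_powers_le q (13/200:R).
by_powers_ge q (67/1000:R).
Qed.

Lemma value1_eq3 q : 8/5 <= q <= 17/10 ->
  q ^+ 3 * state_value q 1 = 1 -> q < 413/250.
Proof.
move=> /andP[a b] /=; rewrite /qe => h.
rewrite ltNge; apply/negP => c; move: h.
by_powers_ge q (13/250:R).
Qed.

(** The equation is the reflected step from state 3 to state 1, multiplied by [q]. *)
Lemma three_to_one q : 8/5 <= q <= 17/10 ->
  q * (1 - poly3 q) = 2 -> 83/50 < q.
Proof.
move=> /andP[a b] /=; rewrite /poly3 => h.
rewrite ltNge; apply/negP => c; move: h.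
by_powers_le q (3/50:R).
Qed.

(** On the interval where state 1 can lead to state 2, [- poly3 q] falls strictly between two
    consecutive powers of [q^-1], so state 2 leads nowhere. *)
Lemma poly3_between q : 333/200 < q < 1667/1000 ->
  q ^+ 3 * - poly3 q < 1 < q ^+ 4 * - poly3 q.
Proof.
move=> /andP[a b] /=; rewrite /poly3; apply/andP; split.
  by_powers_ge q (13/200:R).
by_powers_le q (67/1000:R).
Qed.

(** This and [poly3_small] have opposite conclusions at 209/125; together they exclude steps from
    state 2 to states beyond 4. *)
Lemma offset_lt q : 8/5 <= q <= 17/10 ->
  q ^+ 2 * (qe q * q * (q ^+ 2 - 1)) < 1 -> q < 209/125.
Proof.
move=> /andP[a b] /=; rewrite /qe => h.
rewrite ltNge; apply/negP => c; move: h.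
by_powers_ge q (9/125:R).
Qed.

Lemma poly3_small q : 8/5 <= q <= 17/10 ->
  q ^+ 5 * - poly3 q <= 1 -> 209/125 < q.
Proof.
move=> /andP[a b] /=; rewrite /poly3 => h.
rewrite ltNge; apply/negP => c; move: h.
by_powers_le q (9/125:R).
Qed.

End PolynomialSigns.

(** * Chains of states *)

(** The first three ranges come from a step out of state 1, the last two from a step out of state 0,
    which leads only to state 1. *)
Lemma step_intervals_disjoint (R : realType) (q : R) :
  [\/ 333/200 < q < 1667/1000, q < 413/250 | 67/40 < q] ->
  829/500 < q < 1661/1000 \/ 1673/1000 < q < 67/40 -> False.
Proof. by move=> [/andP[? ?]|?|?] [] /andP[? ?]; lra. Qed.

Section Core.
Variables (R : realType) (q : R).
Hypotheses (q_gt85 : 8/5 < q) (q_lt : q < 1681/1000) (qe_gt0 : 0 < qe q).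
Hypotheses (poly3_neg : poly3 q < 0).

Let r := q^-1.
Let M := qe q * q * (q ^+ 2 - 1).
Let F0 := state_value q 0.
Let F1 := state_value q 1.
Let N := state_total q.

Let q_gt : 809/500 < q.
Proof.
rewrite ltNge; apply/negP => h; move: qe_gt0; rewrite /qe.
have : 0 <= (q - 8/5) * (809/500 - q) by rewrite mulr_ge0; move: q_gt85; lra.
by move: q_gt85; lra.
Qed.
Let q_gt0 : 0 < q. Proof. by move: q_gt85; lra. Qed.
Let q_neq0 : q != 0. Proof. by rewrite gt_eqF. Qed.
Let qr : q * r = 1. Proof. by rewrite /r mulfV. Qed.
Let r_gt0 : 0 < r. Proof. by rewrite invr_gt0. Qed.
Let r_lt1 : r < 1. Proof. by rewrite invf_lt1 //; move: q_gt85; lra. Qed.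
Let r_lt : r < 5/8.
Proof. by rewrite -(ltr_pM2l q_gt0) qr; move: q_gt85; lra. Qed.

Let exp_lt m n : (r ^+ m < r ^+ n) = (n < m)%N.
Proof. exact: ltr_iXn2l. Qed.
Let exp_le m n : (r ^+ m <= r ^+ n) = (n <= m)%N.
Proof. exact: ler_iXn2l. Qed.
Let exp_gt0 n : 0 < r ^+ n. Proof. exact: exprn_gt0. Qed.
Let exp_le1 n : r ^+ n <= 1. Proof. by rewrite -(expr0 r) exp_le. Qed.
Let qrX n : q ^+ n * r ^+ n = 1. Proof. by rewrite -exprMn qr expr1n. Qed.

Let scale_lt n (a : R) : 1 < q ^+ n * a -> r ^+ n < a.
Proof. by rewrite -(qrX n) ltr_pM2l ?exprn_gt0. Qed.
Let scale_gt n (a : R) : q ^+ n * a < 1 -> a < r ^+ n.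
Proof. by rewrite -(qrX n) ltr_pM2l ?exprn_gt0. Qed.

Let q_itv : 8/5 <= q <= 17/10.
Proof. by apply/andP; split; move: q_gt q_lt; lra. Qed.

Let valueS n : state_value q n.+2 = M + r ^+ n. Proof. by []. Qed.
Let N_M : N - M = 1 - poly3 q.
Proof. by rewrite /N /M /state_total /qe /poly3; ring. Qed.

Let M_gt0 : 0 < M.
Proof.
rewrite /M; apply: mulr_gt0; first by rewrite mulr_gt0.
by rewrite subr_gt0 exprn_egt1 //; move: q_gt; lra.
Qed.

Let M_le1 : M <= F1.
Proof.
rewrite /F1 /= /M ler_pM2l; last by rewrite mulr_gt0.
rewrite -subr_ge0.
have -> : q ^+ 3 - q - 1 - (q ^+ 2 - 1) = q * qe q by rewrite /qe; ring.
by rewrite mulr_ge0 ?ltW.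
Qed.

Let M_le0 : M <= F0.
Proof.
rewrite /F0 /= /M ler_pM2l; last by rewrite mulr_gt0.
rewrite -subr_ge0.
have -> : q ^+ 4 - q ^+ 2 - 1 - (q ^+ 2 - 1) = q ^+ 2 * (q ^+ 2 - 2) by ring.
apply: mulr_ge0; first by rewrite exprn_ge0 // ltW.
by move: qe_gt0 q_gt; rewrite /qe; lra.
Qed.

Let F0_lt1 : F0 < 1.
Proof.
rewrite -subr_lt0.
have -> : F0 - 1 = poly3 q * (q ^+ 2 - 1).
  by rewrite /F0 /= /qe /poly3; ring.
by rewrite nmulr_rlt0 // subr_gt0 exprn_egt1 //; move: q_gt; lra.
Qed.

Let F1_lt : F1 < r.
Proof.
rewrite -[r]expr1; apply: scale_gt; apply: value1_lt.
by rewrite (ltW q_gt) (ltW q_lt).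
Qed.

Let poly3_gt : - poly3 q < r.
Proof.
rewrite -[r]expr1; apply: scale_gt; rewrite expr1 -subr_gt0.
have -> : 1 - q * - poly3 q = qe q * (q ^+ 4 - 1).
  by rewrite /poly3 /qe; ring.
by rewrite mulr_gt0 // subr_gt0 exprn_egt1 //; move: q_gt; lra.
Qed.

(** Hence the sign of [poly1 q] decides whether [- poly3 q] is above or below [r ^+ 2]. *)
Let poly1E : (q - 1) * poly1 q = q ^+ 2 * poly3 q + 1.
Proof. by rewrite /poly1 /poly3; ring. Qed.

Let r2_lt : r + r ^+ 2 < 1.
Proof.
rewrite -subr_gt0.
have -> : 1 - (r + r ^+ 2) = r ^+ 2 * qe q.
  by rewrite /qe /r; field.
by rewrite mulr_gt0.
Qed.

Let between m n (a : R) : r ^+ m < a -> a < r ^+ n ->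
  forall i : nat, r ^+ i = a -> (n < i < m)%N.
Proof. by move=> h h' i E; rewrite -!exp_lt E h h'. Qed.

(* As every [state_value q j] is at least [M], a step [r ^+ i = state_value q j]
   to a state [i >= 2] cannot be followed by another one. *)
Lemma value_step_lt n i : r ^+ i = M + r ^+ n -> (i < n)%N /\ r ^+ n.+2 < M.
Proof.
move=> E; have : (i < n)%N by rewrite -exp_lt E ltrDr.
case: n E => // n E; rewrite ltnS => ni; split => //.
have : r ^+ n <= r ^+ i by rewrite exp_le.
rewrite E !exprS; move: (r ^+ n) (exp_gt0 n) => x x0.
(* This amounts to [r + r ^+ 3 < 1], a consequence of [r + r ^+ 2 < 1]. *)
have : r * (r * (r * x)) < x - r * x; last by move=> *; lra.
rewrite -subr_gt0; have -> : x - r * x - r * (r * (r * x)) =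
  x * (1 - r - r ^+ 2 + r ^+ 2 * (1 - r)) by ring.
rewrite mulr_gt0 // addr_gt0 ?mulr_gt0 ?exprn_gt0 //; last by rewrite subr_gt0.
by move: r2_lt; lra.
Qed.

(** To be instantiated by the states whose point is unforked. A step is called direct or reflected
    according to the alternative that holds. *)
Variable g : nat -> Prop.
Hypothesis g_step : forall j, g j -> exists2 i, g i &
  r ^+ i = state_value q j \/ r ^+ i = N - state_value q j.

(** Below [q1] every step is direct. A direct step to a state [i >= 2] is a dead end, since then
    [M <= r ^+ i]. State 1 leads only to such states, state 0 only to these or to 1, and so no state
    survives. *)
Lemma no_state_below_q1 j : poly1 q < 0 -> ~ g j.
Proof.
move=> p1; have q1 := poly1_lt0 q_itv p1.
have p3 : r ^+ 2 < - poly3 q.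
  apply: scale_lt; have : (q - 1) * poly1 q < 0.
    by rewrite pmulr_rlt0 // subr_gt0; move: q_gt; lra.
  by rewrite poly1E; lra.
have value_step k : g k -> exists2 i, g i & r ^+ i = state_value q k.
  move=> /g_step[i gi [E|E]]; first by exists i.
  have i1 := exp_le1 i; exfalso; move: E; case: k => [|[|n]].
  - have : 1 < N - F0.
      by apply: total_sub0_gt1; rewrite (ltW q_gt) (ltW q1).
    by rewrite /F0; lra.
  - have : 1 < N - F1.
      by apply: total_sub1_gt1; apply/andP; split; move: q1 q_gt; lra.
    by rewrite /F1; lra.
  (* For state 2, [- poly3 q] lies strictly between [r ^+ 2] and [r]; for state 3 the right side
     lies strictly between [r] and 1; beyond, it exceeds 1. *)
  - rewrite valueS opprD addrA N_M; case: n => [|[|n]] E.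
    + have : r ^+ i = - poly3 q by rewrite E expr0; ring.
      move=> /(@between 2 1 _ p3); rewrite expr1 => /(_ poly3_gt).
      by case: i {gi i1 E} => [|[|]].
    + have h1 : r ^+ 1 < r ^+ i by rewrite E expr1; nra.
      have h0 : r ^+ i < r ^+ 0.
        by rewrite E expr0 expr1; move: poly3_gt; lra.
      by move: h1 h0; rewrite !exp_lt; case: i {gi i1 E}.
    + have : r ^+ n.+2 <= r ^+ 2 by rewrite exp_le.
      by move: i1; rewrite E; lra.
have dead2 n : M <= r ^+ n.+2 -> ~ g n.+2.
  by move=> h /value_step[i _ /value_step_lt[_]]; lra.
have dead1 : ~ g 1.
  move=> /value_step[i gi E].
  have : (1 < i)%N by rewrite -exp_lt E expr1.
  by case: i gi E => [|[|i]] // gi E _; apply: dead2 gi; rewrite E.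
have dead0 : ~ g 0.
  move=> /value_step[i gi E].
  have : (0 < i)%N by rewrite -exp_lt E expr0.
  by case: i gi E => [|[|i]] // gi E _; apply: dead2 gi; rewrite E.
case: j => [|[|n]] // /value_step[i gi E].
by case: i gi E => [|[|i]] // gi E; apply: dead2 gi; rewrite E lerDl ltW.
Qed.

(** State 0 leads only to 1, state 1 only to 0, 2 or 3, state 3 only to 1, each step confining [q];
    these ranges are incompatible, which removes 0, 1 and 3. From 4 on, steps are direct and lower
    the state, so all ends with the exclusion of state 2. *)
Lemma no_state_above_q1 j : 0 < poly1 q -> poly2 q != 0 -> ~ g j.
Proof.
move=> p1 p2; have q1 := poly1_gt0 q_itv p1.
have q_itv1 : 809/500 <= q <= 1681/1000.
  by rewrite (ltW q_gt) (ltW q_lt).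
have p3 : - poly3 q < r ^+ 2.
  apply: scale_gt; have : 0 < (q - 1) * poly1 q.
    by rewrite mulr_gt0 // subr_gt0; move: q_gt; lra.
  by rewrite poly1E; lra.
have scale i (a : R) : r ^+ i = a -> q ^+ i * a = 1 by move=> <-.
have step0 : g 0 -> g 1 /\ 
    (829/500 < q < 1661/1000 \/ 1673/1000 < q < 67/40).
  move=> /g_step[i gi [E|E]].
    have h : r ^+ 2 < F0.
      apply: scale_lt; rewrite -subr_gt0.
      have -> : q ^+ 2 * F0 - 1 = poly1 q * ((q - 1) ^+ 2 * (q + 1)).
        by rewrite /F0 /= /qe /poly1; ring.
      rewrite mulr_gt0 // mulr_gt0 ?exprn_gt0 //; move: q_gt; lra.
    have := @between 2 0 _ h F0_lt1 _ E.
    case: i gi E => [|[|i]] // gi E _; split => //; left.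
    by apply: value0_eq => //; exact: (scale 1).
  have h : r ^+ 2 < r ^+ i by rewrite E; apply: scale_lt; exact: total_sub0_gt.
  move: h; rewrite exp_lt; case: i gi E => [|[|i]] // gi E _.
    (* A reflected return of state 0 to itself is the equation [poly2 q = 0]. *)
    case/eqP: p2; apply: (mulfI (x := 1 - q)).
      by apply/eqP; move: q_gt; lra.
    rewrite mulr0; transitivity (N - state_value q 0 - 1).
      by rewrite /N /state_total /= /qe /poly2; ring.
    by rewrite -E expr0 subrr.
  by split => //; right; apply: total_sub0_eq => //; exact: (scale 1).
have step1 : g 1 -> [\/ g 2 /\ 333/200 < q < 1667/1000, g 3 /\ q < 413/250
    | g 0 /\ 67/40 < q].
  move=> /g_step[i gi [E|E]].
    have h : r ^+ 4 < F1.
      by apply: scale_lt; apply: value1_gt; rewrite (ltW q1) (ltW q_lt).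
    have h1 : F1 < r ^+ 1 by rewrite expr1.
    have := between h h1 E; case: i gi E => [|[|[|[|i]]]] // gi E _.
      by apply: Or31; split => //; apply: value1_eq2 => //; exact: scale.
    by apply: Or32; split => //; apply: value1_eq3 => //; exact: scale.
  have h : r ^+ 1 < r ^+ i by rewrite E; apply: scale_lt; exact: total_sub1_gt.
  move: h; rewrite exp_lt; case: i gi E => // gi E _; apply: Or33; split => //.
  rewrite ltNge; apply/negP => h.
  have : 1 < N - F1.
    by apply: total_sub1_gt1; rewrite (ltW q_gt) h.
  by rewrite /F1 -E expr0 ltxx.
have dead0 : ~ g 0.
  move=> /step0[/step1 s1]; apply: step_intervals_disjoint.
  by case: s1 => -[_ ?]; [apply: Or31|apply: Or32|apply: Or33].
have step3 : g 3 -> g 1 /\ 83/50 < q.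
  move=> /g_step[i gi []]; rewrite valueS.
    by move=> /value_step_lt[]; case: i gi.
  rewrite opprD addrA N_M expr1 => E.
  have h : r ^+ 2 < r ^+ i.
    by rewrite E ltrBrDl (lt_trans r2_lt) // ltrDl oppr_gt0.
  move: h; rewrite exp_lt; case: i gi E => [|[|i]] // gi E _.
  split => //; apply: three_to_one => //.
  have -> : 1 - poly3 q = 2 * r.
    by rewrite mulr_natl mulr2n -{1}[r]expr1 E subrK.
  by rewrite mulrCA qr mulr1.
have step2 : g 2 -> exists i, [/\ g i, r ^+ i = - poly3 q & (2 < i)%N].
  move=> /g_step[i gi []]; rewrite valueS; first by move=> /value_step_lt[].
  rewrite opprD addrA N_M expr0 => E.
  have E' : r ^+ i = - poly3 q by rewrite E; ring.
  by exists i; split => //; rewrite -exp_lt E'.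
have dead1 : ~ g 1.
  move=> /step1[[/step2[i [_ E _]] qi]|[/step3[_ h]]|[]//]; last first.
    by apply/negP; rewrite -leNgt (le_trans _ (ltW h)) //; lra.
  have /andP[h3 h4] : q ^+ 3 * - poly3 q < 1 < q ^+ 4 * - poly3 q.
    exact: poly3_between.
  have := between (scale_lt h4) (scale_gt h3) E.
  by case: i {E} => [|[|[|[|[|]]]]].
have dead3 : ~ g 3 by move=> /step3[].
have step4 n : g n.+4 -> exists2 i, g i & r ^+ i = M + r ^+ n.+2.
  move=> /g_step[i gi []]; rewrite valueS; first by exists i.
  rewrite opprD addrA N_M => E; exfalso.
  have h2 : r ^+ n.+2 <= r ^+ 2 by rewrite exp_le.
  have h : r ^+ 1 < r ^+ i.
    rewrite E expr1 ltrBrDr (lt_trans (y := 1)) ?ltrDl ?oppr_gt0 //.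
    by rewrite (le_lt_trans _ r2_lt) // lerD2l.
  by move: h; rewrite exp_lt; case: i gi E.
(* The descending chain from [k] can only stop at state 2, where [r ^+ 2] is [M] plus a positive
   power. *)
have M_lt k : (2 < k)%N -> g k -> M < r ^+ 2.
  elim/ltn_ind: k => -[|[|[|[|n]]]] // IH _ /step4[i gi E].
  have [ni _] := value_step_lt E.
  case: i gi E ni => [|[|[|i]]] // gi E ni; first by rewrite E ltrDl.
  by apply: IH gi => //; rewrite (ltn_trans ni).
have dead2 : ~ g 2.
  move=> /step2[i [gi E i2]]; have Ml := M_lt _ i2 gi.
  have q2 : q < 209/125.
    by apply: offset_lt => //; rewrite -[ltRHS](qrX 2) ltr_pM2l ?exprn_gt0.
  (* State 3 is already excluded, state 4 leads only to 0 or 1, and [i >= 5] makes [- poly3 q] too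
     small. *)
  case: i gi E i2 => [|[|[|[|[|i]]]]] // gi E _.
    have [i gi' E'] := step4 _ gi; have [] := value_step_lt E'.
    by case: i gi' E' => [|[|]].
  suff : 209/125 < q by rewrite ltNge (ltW q2).
  apply: poly3_small => //; rewrite -(qrX 5) ler_pM2l ?exprn_gt0 //.
  by rewrite -E exp_le.
elim/ltn_ind: j => -[|[|[|[|n]]]] // IH /step4[i gi E].
have [ni _] := value_step_lt E.
by apply: IH gi; rewrite (ltn_trans ni).
Qed.

End Core.

(** * Unique expansions and returns to states *)

Section Transitions.
Variables (R : realType) (q : R).
Hypotheses (q_gt85 : 8/5 < q) (q_lt : q < 1681/1000) (qe_gt0 : 0 < qe q).

Let r := q^-1.
Let L := 1 / (q - 1).
Let N := state_total q.
Let M := qe q * q * (q ^+ 2 - 1).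
(** The value of the expansion 00(10)^oo. *)
Definition unit_state := 1 / (q * (q ^+ 2 - 1)).
Let c := unit_state.

Let q_gt1 : 1 < q. Proof. by move: q_gt85; lra. Qed.
Let q_lt2 : q < 2. Proof. by move: q_lt; lra. Qed.
Let q_gt0 : 0 < q. Proof. by move: q_gt85; lra. Qed.
Let q_neq0 : q != 0. Proof. by rewrite gt_eqF. Qed.
Let q1_neq0 : q - 1 != 0. Proof. by rewrite subr_eq0 gt_eqF. Qed.
Let q2_gt1 : 1 < q ^+ 2. Proof. by rewrite exprn_egt1. Qed.
Let q2_neq0 : q ^+ 2 - 1 != 0. Proof. by rewrite subr_eq0 gt_eqF. Qed.
Let qr : q * r = 1. Proof. by rewrite /r mulfV. Qed.
Let r_gt0 : 0 < r. Proof. by rewrite invr_gt0. Qed.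
Let r_lt1 : r < 1. Proof. by rewrite invf_lt1. Qed.
Let r_lt : r < 5/8.
Proof. by rewrite -(ltr_pM2l q_gt0) qr; move: q_gt85; lra. Qed.
Let c_gt0 : 0 < c.
Proof. by rewrite divr_gt0 // mulr_gt0 // subr_gt0. Qed.
Let cE : c * (q * (q ^+ 2 - 1)) = 1.
Proof. by rewrite /c /unit_state divfK // mulf_neq0. Qed.
Let LE : q * L = L + 1. Proof. by rewrite /L; field. Qed.
Lemma total_eq : L - 1 = c * N.
Proof.
rewrite /L /c /unit_state /N /state_total; field.
by rewrite q_neq0 q2_neq0 q1_neq0.
Qed.
Let L1E := total_eq.
Let L_lt : L < q.
Proof.
rewrite /L ltr_pdivrMr ?subr_gt0 // -subr_gt0.
by move: qe_gt0; rewrite /qe; lra.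
Qed.
Let L_gt : 73/50 < L.
Proof.
by rewrite /L ltr_pdivlMr ?subr_gt0 //; move: q_gt85 q_lt; lra.
Qed.
Let M_gt0 : 0 < M. Proof. by rewrite !mulr_gt0 // subr_gt0. Qed.
Let exp_gt0 n : 0 < r ^+ n. Proof. exact: exprn_gt0. Qed.
Let exp_le1 n : r ^+ n <= 1. Proof. by rewrite exprn_ile1 // ltW. Qed.
Let exp_lt m n : (r ^+ m < r ^+ n) = (n < m)%N.
Proof. exact: ltr_iXn2l. Qed.

Let q_itv : 8/5 <= q <= 1681/1000. Proof. by rewrite !ltW. Qed.
Let N_gt : 7/5 < N. Proof. exact: total_gt. Qed.

Let N_lt : N < 1 + r.
Proof.
rewrite -(ltr_pM2l q_gt0) mulrDr mulr1 qr -subr_gt0.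
have -> : q + 1 - q * N = (q + 1) * (q - 1) * qe q.
  by rewrite /N /state_total /qe; ring.
by rewrite mulr_gt0 // mulr_gt0 ?subr_gt0 // addr_gt0.
Qed.

Let N_lt_q : N < q.
Proof.
rewrite -subr_gt0; have -> : q - N = q * qe q.
  by rewrite /N /state_total /qe; ring.
exact: mulr_gt0.
Qed.

(* The value of the expansion (10)^oo. *)
Definition alternating := c * q ^+ 2.
Let z0 := alternating.

Let z0E : q * (q * z0 - 1) = z0.
Proof.
by rewrite /z0 /alternating /c /unit_state; field; rewrite q_neq0 q2_neq0.
Qed.

Let z0_gt0 : 0 < z0. Proof. by rewrite mulr_gt0 // exprn_gt0. Qed.

Let z0_lt1 : z0 < 1.
Proof.
rewrite -cE /z0 /alternating ltr_pM2l // -subr_gt0.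
have -> : q * (q ^+ 2 - 1) - q ^+ 2 = q * qe q by rewrite /qe; ring.
exact: mulr_gt0.
Qed.

(* Invariant under the expanding affine map [z |-> q * (q * z - 1)], hence
   reduced to its fixed point. *)
Let gap z := [/\ switch_free q z, L < q * z & z < 1].

Let gap_step z : gap z -> gap (q * (q * z - 1)).
Proof.
move=> [sz z1 z2].
have sf : switch_free q (q * (q * z - 1)).
  have := @switch_free_walk _ q [:: true; false] _ sz.
  by rewrite /walk /= subr0.
have s1 := sz [:: true]; rewrite /walk /= /in_switch -/L in s1.
have s2 := sf [::]; rewrite /walk /= /in_switch -/L in s2.
(* Otherwise [q * z - 1] would be a switch point, because [z < 1] gives
   [q * (q * z - 1) <= q * (q - 1) < L]. *)
have h1 : q * (q * z - 1) < 1.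
  rewrite ltNge; apply/negP => h; apply: s1; rewrite h /=.
  have : q * (q * z - 1) <= q * (q - 1).
    by rewrite ler_pM2l // lerD2r ger_pMr // ltW.
  have : 0 <= (1681/1000 - q) * (q + 681/1000).
    by apply: mulr_ge0; move: q_lt q_gt0; lra.
  by move: L_gt; lra.
have h2 : 1 <= q * (q * (q * z - 1)).
  have : q * (q * (L - 1)) < q * (q * (q * z - 1)).
    by rewrite !ltr_pM2l // ltrD2r.
  have -> : q * (q * (L - 1)) = q * (L + 1 - q) by rewrite -LE; ring.
  have : (8/5) * (3/4) <= q * (L + 1 - q).
    by apply: ler_pM; move: L_gt q_gt85 q_lt; lra.
  lra.
split => //; rewrite ltNge; apply/negP => h; apply: s2.
by rewrite h2.
Qed.

Let gapP z : gap z -> z = z0.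
Proof.
move=> gz.
(* Each pass multiplies the distance to [z0] by [q ^+ 2 > 2], while it stays at most 1 inside the
   gap. *)
have H n : forall z, gap z -> 2 ^+ n * `|z - z0| <= 1.
  elim: n => [|n IH] y gy.
    rewrite mul1r ler_norml; have [_ y1 y2] := gy.
    have : 0 < y.
      rewrite -(pmulr_rgt0 _ q_gt0); apply: lt_trans y1.
      by move: L_gt; lra.
    by move: z0_gt0 z0_lt1 y2 => *; apply/andP; split; lra.
  apply: le_trans (IH _ (gap_step gy)); rewrite exprS -mulrA.
  rewrite mulrCA ler_pM2l ?exprn_gt0 //.
  have -> : q * (q * y - 1) - z0 = q ^+ 2 * (y - z0).
    by rewrite -[in LHS]z0E; ring.
  rewrite normrM ler_wpM2r // ger0_norm ?exprn_ge0 // ?ltW //.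
  by move: qe_gt0 q_gt1; rewrite /qe; lra.
apply/eqP; rewrite -subr_eq0 -normr_eq0; apply/negP => /negP nz.
have d0 : 0 < `|z - z0| by rewrite lt0r nz normr_ge0.
have := upper_nthrootP (leqnn (Num.bound (`|z - z0|^-1))).
rewrite ltNge => /negP; apply.
by rewrite -(ler_pM2r d0) mulVf // H.
Qed.

(** Multiply a positive [u] by [q] up to the last point before the product reaches 1. Having no
    switch point, the orbit jumps over the switch region there, so that point is in the gap and
    equals [z0]. The bound [L - 1] forces at least two leading zeros, whence the shift by
    [q ^+ 2]. *)
Lemma switch_free_value u : switch_free q u -> 0 <= u <= L - 1 ->
  u = 0 \/ exists j : nat, u = c * r ^+ j.
Proof.
move=> su /andP[]; rewrite le0r => /predU1P[->|u0 u1]; first by left.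
right; have [] := @ex_minnP (fun n => 1 <= q * (q ^+ n * u)).
  exists (Num.bound (u^-1)).*2.
  have := upper_nthrootP (leqnn (Num.bound (u^-1))).
  set n := Num.bound _ => h; rewrite mulrA -exprS -(mulVf (lt0r_neq0 u0)).
  rewrite ler_pM2r // (le_trans (ltW h)) // -muln2 mulnC exprS exprM.
  apply: (@le_trans _ _ ((q ^+ 2) ^+ n)).
    apply: lerXn2r; rewrite ?nnegrE ?exprn_ge0 ?ltW //.
    by move: qe_gt0 q_gt1; rewrite /qe; lra.
  by rewrite ler_peMl ?exprn_ge0 // ?ltW.
move=> n n1 nmin.
have walk0 k : walk q (nseq k false) u = q ^+ k * u.
  elim: k => [|k IH]; first by rewrite mul1r.
  by rewrite -addn1 nseqD walk_cat IH /walk /= subr0 addn1 exprS mulrA.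
have gn : L < q * (q ^+ n * u).
  rewrite ltNge; apply/negP => h; apply: (su (nseq n false)).
  by rewrite walk0 /in_switch -/L n1 h.
case: n => [|n] in n1 nmin gn *.
  move: gn; rewrite mul1r ltNge => /negP[].
  apply: (@le_trans _ _ (q * (L - 1))); first by rewrite ler_pM2l.
  by rewrite mulrBr LE mulr1; move: q_gt1; lra.
have lt1 : q ^+ n.+1 * u < 1.
  rewrite exprS -mulrA ltNge; apply/negP => /nmin; by rewrite ltnn.
have E : q ^+ n.+1 * u = z0.
  by apply: gapP; split => //; rewrite -walk0; exact: switch_free_walk.
move: E; rewrite /z0 /alternating => E.
have uE k : q ^+ k * (u / c) = q ^+ 2 -> u = c * (q ^+ 2 * r ^+ k).
  move=> <-; rewrite [q ^+ k * _]mulrC -[_ * r ^+ k]mulrA.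
  rewrite -exprMn qr expr1n mulr1.
  by rewrite mulrC divfK // gt_eqF.
have {}E : u = c * (q ^+ 2 * r ^+ n.+1).
  by apply: uE; rewrite mulrA E mulrAC mulfV ?mul1r // gt_eqF.
case: n => [|n] in n1 nmin gn lt1 E *.
  move: u1; rewrite E L1E ler_pM2l // expr1 expr2 -mulrA qr mulr1.
  by rewrite leNgt N_lt_q.
exists n; rewrite E !exprS expr0; congr (_ * _).
by transitivity ((q * r) * (q * r) * r ^+ n); [ring | rewrite qr !mul1r].
Qed.

(** Inside the interval the orbit is forced: it descends through the exponents to 0, then alternates
    between exponents 1 and 0. *)
Lemma switch_free_power k : switch_free q (c * (q ^+ 2 * r ^+ k)).
Proof.
pose v k := c * (q ^+ 2 * r ^+ k).
have v0 : v 0%N = z0 by rewrite /v mulr1.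
have vS n : q * v n.+1 = v n.
  rewrite /v [r ^+ n.+1]exprS.
  transitivity (q * r * (c * (q ^+ 2 * r ^+ n))); first by ring.
  by rewrite qr mul1r.
have v_lt1 n : v n < 1.
  apply: le_lt_trans z0_lt1; rewrite /z0 /alternating ler_pM2l //.
  by rewrite ler_piMr // exprn_ge0 // ltW.
have v1 : q * v 0%N - 1 = v 1%N.
  by apply: (mulfI q_neq0); rewrite v0 z0E vS v0.
have gt0 : L < q * v 0%N.
  rewrite -[ltRHS](subrK 1) v1 -ltrBlDr L1E ltr_pM2l // expr1 expr2 -mulrA.
  by rewrite qr mulr1.
have next_in_I w b y :
    in_switch q (walk q (b :: w) y) -> in_I q (q * y - b%:R).
  move=> /(in_switchP q_gt1)[/(in_I_preimage q_gt1) Iw _].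
  exact: (in_I_walk q_gt1 (w := w) Iw).
move=> w; rewrite -/(v k); elim: w k => [|b w IH] [|k] /andP[h1 h2].
- by move: h2; rewrite -/L leNgt gt0.
- by move: h1; rewrite vS leNgt v_lt1.
- have /andP[_] := next_in_I _ _ _ (introT andP (conj h1 h2)).
  case: b h1 h2 => h1 h2 /= i2.
    by apply: (IH 1%N); rewrite -v1; apply/andP.
  by move: i2; rewrite subr0 leNgt gt0.
- have /andP[+ _] := next_in_I _ _ _ (introT andP (conj h1 h2)).
  case: b h1 h2 => h1 h2 i1.
    by move: i1; rewrite vS subr_ge0 leNgt v_lt1.
  by apply: (IH k); rewrite -vS -[_ * _]subr0; apply/andP.
Qed.

Lemma switch_free_state k : switch_free q (c * r ^+ k).
Proof.
have -> : c * r ^+ k = c * (q ^+ 2 * r ^+ k.+2); last exact: switch_free_power.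
rewrite !exprS expr0; congr (_ * _).
by transitivity ((q * r) * (q * r) * r ^+ k); [rewrite qr !mul1r | ring].
Qed.

(** Both branches would write [N] as [a + b] with [a], [b] zero or powers of [r]. But
    [7/5 < N < 1 + r]: two terms at most [r] are too small, and a term 1 would leave the other
    strictly between [r ^+ 2] and [r]. *)
Lemma not_both_switch_free y : in_switch q y ->
  switch_free q (q * y - false%:R) -> switch_free q (q * y - true%:R) -> False.
Proof.
move=> /andP[y1 y2]; rewrite subr0 (_ : true%:R = 1) // => s0 s1.
have [a [aP ay]] : exists a, (a = 0 \/ exists j : nat, a = r ^+ j) /\
    q * y - 1 = c * a.
  have [|->|[j ->]] := switch_free_value s1.
  - by apply/andP; split; move: y1 y2; rewrite -/L; lra.
  - by exists 0; rewrite mulr0; split => //; left.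
  - by exists (r ^+ j); split => //; right; exists j.
have [b [bP By]] : exists b, (b = 0 \/ exists j : nat, b = r ^+ j) /\
    L - q * y = c * b.
  have [|->|[j ->]] := switch_free_value (switch_free_reflect q_gt1 s0).
  - by apply/andP; split; move: y1 y2; rewrite -/L; lra.
  - by exists 0; rewrite mulr0; split => //; left.
  - by exists (r ^+ j); split => //; right; exists j.
have ab : a + b = N.
  by apply: (mulfI (lt0r_neq0 c_gt0)); rewrite mulrDr -ay -By -L1E; ring.
have r2 : r ^+ 2 < 2/5 by rewrite expr2; move: r_gt0 r_lt; nra.
have no1 x : (x = 0 \/ exists j : nat, x = r ^+ j) -> 1 + x = N -> False.
  move=> [->|[j ->]] E; first by move: N_gt; rewrite -E; lra.
  have : r ^+ 2 < r ^+ j by move: N_gt; rewrite -E; lra.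
  have : r ^+ j < r ^+ 1 by move: N_lt; rewrite -E; lra.
  by rewrite !exp_lt; case: j {E} => [|[|]].
have ler x : (x = 0 \/ exists j : nat, x = r ^+ j) -> x = 1 \/ x <= r.
  move=> [->|[[|j] ->]]; first by right; apply: ltW.
    by left.
  right; rewrite -[leRHS]expr1 leNgt exp_lt; by [].
have [a1|ar] := ler _ aP; first by apply: (no1 _ bP); rewrite -ab a1.
have [b1|br] := ler _ bP; first by apply: (no1 _ aP); rewrite -ab b1 addrC.
by move: N_gt r_lt; rewrite -ab; lra.
Qed.

Lemma first_step_gt a : 0 <= a -> L < q * (1 + c * a).
Proof.
move=> a0; apply: (lt_le_trans L_lt); apply: ler_peMr; first exact: ltW.
by rewrite lerDl mulr_ge0 // ltW.
Qed.

Lemma first_step_eq a :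
  q * (q * (1 + c * a) - 1) - 1 = c * (M + q ^+ 2 * a).
Proof.
have cM : c * M = qe q.
  by rewrite /M -[qe q * q * _]mulrA mulrCA cE mulr1.
by rewrite [RHS]mulrDr cM /qe; ring.
Qed.

(** One digit 1 is forced from every state. Two more are forced when [j = 0] and one more when
    [j = 1], as long as the coefficient of [c] exceeds [N]. *)
Lemma state_path j :
  exists2 w, forced q (1 + c * r ^+ j) w & q * w - 1 = c * state_value q j.
Proof.
have gt1 := first_step_gt (ltW (exp_gt0 j)).
have := first_step_eq (r ^+ j); set x := q * (1 + c * r ^+ j) - 1 in gt1 *.
have ltcN (F : R) : N < F -> L < c * F + 1.
  by move=> NF; rewrite -ltrBlDr L1E ltr_pM2l.
case: j gt1 @x => [|[|n]] gt1 x xE.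
- rewrite mulr1 in xE.
  have E1 : q * (q * x - 1) - 1 = c * (q * M + q).
    by rewrite xE -{1}cE; ring.
  exists (q * (q * x - 1) - 1).
    apply: (forced_right gt1); apply: forced_right.
      rewrite -[ltRHS](subrK 1) xE; apply: ltcN.
      apply: (lt_trans N_lt_q); rewrite ltr_wpDl ?ltW // expr2.
      by rewrite ltr_pMr.
    apply: forced_right (forced_refl _ _).
    rewrite -[ltRHS](subrK 1) E1; apply: ltcN.
    by apply: (lt_trans N_lt_q); rewrite ltrDr mulr_gt0.
  by rewrite E1 -{1}cE /= /M /qe; ring.
- rewrite expr1 expr2 -mulrA qr mulr1 in xE.
  exists (q * x - 1).
    apply: (forced_right gt1); apply: forced_right (forced_refl _ _).
    rewrite -[ltRHS](subrK 1) xE; apply: ltcN.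
    by apply: (lt_trans N_lt_q); rewrite ltrDr.
  by rewrite xE -{1}cE /= /M /qe; ring.
- exists x; first exact: (forced_right gt1 (forced_refl _ _)).
  rewrite xE /= -/M -/r; congr (_ * (_ + _)).
  rewrite !exprS expr0.
  by transitivity ((q * r) * (q * r) * r ^+ n); [ring | rewrite qr !mul1r].
Qed.

(** One branch at [w] has finitely many expansions, hence is switch-free, and its value is [c * a]
    up to reflection. The other branch is infinite, hence unforked, and is [1 + c * a] up to the
    same reflection. *)
Lemma unforked_switch w F : unforked q w -> q * w - 1 = c * F -> 0 <= F <= N ->
  exists a, [/\ a = 0 \/ exists j : nat, a = r ^+ j, unforked q (1 + c * a) &
    a = F \/ a = N - F].
Proof.
move=> uw wF /andP[F0 FN]; have [iw nw] := uw.
have cF0 : 0 <= c * F by rewrite mulr_ge0 // ltW.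
have cFN : c * F <= c * N by rewrite ler_pM2l.
have value a : switch_free q (c * a) -> 0 <= c * a <= c * N ->
    a = 0 \/ exists j : nat, a = r ^+ j.
  move=> sa; rewrite -L1E => /(switch_free_value sa)[/eqP|[j]].
    by rewrite mulf_eq0 (gt_eqF c_gt0) => /eqP ->; left.
  by move=> /(mulfI (lt0r_neq0 c_gt0)) ->; right; exists j.
have [fin0|inf0] := pselect (finite_set (Sigma_ q (q * w - false%:R))).
  exists (N - F); split; last by right.
    have E : L - q * w = c * (N - F) by rewrite mulrBr -L1E -wF; ring.
    apply: value; last by rewrite mulrBr; apply/andP; split; lra.
    rewrite -E; apply: (switch_free_reflect q_gt1).
    rewrite -[q * w]subr0; apply: (finite_switch_free q_gt1 q_lt2) fin0.
    exact: not_both_switch_free.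
  have -> : 1 + c * (N - F) = L - (q * w - 1) by rewrite mulrBr -L1E -wF; ring.
  apply: (unforked_reflect q_gt1).
  apply: (unforked_walk (w := [:: true])) uw.
  exact: (infinite_child q_gt1 (b := true)).
exists F; split; last by left.
  apply: value; last by rewrite cF0.
  rewrite -wF; apply: (finite_switch_free q_gt1 q_lt2).
    exact: not_both_switch_free.
  apply: contrapT => inf1.
  by apply: (nw [::]); split; [exact: inf0 | exact: inf1].
rewrite -wF addrC subrK -[q * w]subr0.
exact: (unforked_walk (w := [:: false]) inf0 uw).
Qed.

Lemma unforked_switch_pos w F : unforked q w -> q * w - 1 = c * F ->
  0 < F < N -> exists2 i : nat, unforked q (1 + c * r ^+ i) &
    r ^+ i = F \/ r ^+ i = N - F.
Proof.
move=> uw wF /andP[F0 FN].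
have [|a [[a0|[j aj]] ua aF]] := unforked_switch uw wF.
- by rewrite !ltW.
- by exfalso; case: aF; rewrite a0; lra.
- by exists j; rewrite -aj.
Qed.

Hypothesis poly3_neg : poly3 q < 0.

Let N_M : N - M = 1 - poly3 q.
Proof. by rewrite /N /M /state_total /qe /poly3; ring. Qed.

Let value_itv j : 0 < state_value q j < N.
Proof.
have q_itv1 : 809/500 <= q <= 1681/1000.
  rewrite (ltW q_lt) andbT leNgt; apply/negP => h.
  have : 0 <= (q - 8/5) * (809/500 - q).
    by apply: mulr_ge0; move: q_gt85 h; lra.
  by move: qe_gt0 q_gt85 h; rewrite /qe; lra.
have q22 : 13/5 < q ^+ 2 by move: qe_gt0 q_gt85; rewrite /qe; lra.
have q23 : 13/5 < q ^+ 3.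
  by rewrite exprS; move: q22 q_gt1; nra.
case: j => [|[|n]]; apply/andP; split.
- apply: mulr_gt0; first exact: mulr_gt0.
  have -> : q ^+ 4 - q ^+ 2 - 1 = q ^+ 2 * (q ^+ 2 - 1) - 1 by ring.
  by move: q22; nra.
- rewrite -subr_gt0 -(pmulr_rgt0 _ (exprn_gt0 2 q_gt0)).
  exact: lt_trans (total_sub0_gt q_itv1).
- apply: mulr_gt0; first exact: mulr_gt0.
  have -> : q ^+ 3 - q - 1 = q * (q ^+ 2 - 1) - 1 by ring.
  by move: q22 q_gt1; nra.
- rewrite -subr_gt0 -(pmulr_rgt0 _ q_gt0).
  exact: lt_trans (total_sub1_gt q_itv1).
- exact: addr_gt0.
- rewrite /= -/M -ltrBrDl N_M (le_lt_trans (exp_le1 n)) //.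
  by rewrite ltrDl oppr_gt0.
Qed.

Lemma state_transition j : unforked q (1 + c * r ^+ j) ->
  exists2 i : nat, unforked q (1 + c * r ^+ i) &
    r ^+ i = state_value q j \/ r ^+ i = N - state_value q j.
Proof.
move=> uj; have [w jw wE] := state_path j.
exact: unforked_switch_pos (unforked_forced q_gt1 jw uj) wE (value_itv j).
Qed.

Lemma unforked_meets_switch x : unforked q x ->
  exists2 y, unforked q y & in_switch q y.
Proof.
move=> ux.
have [w] : exists w, in_switch q (walk q w x).
  apply: contrapT => nw; have [+ _] := ux; apply.
  by apply: (switch_free_finite q_gt1) => w sw; apply: nw; exists w.
elim: w x ux => [|b w IH] x ux sw; first by exists x.
have [sx|nsx] := pselect (in_switch q x); first by exists x.
have Ib : in_I q (q * x - b%:R).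
  have [/(in_I_preimage q_gt1) Iw _] := (in_switchP q_gt1 _).1 sw.
  exact: (in_I_walk q_gt1 (w := w) Iw).
apply: IH (sw).
apply: (unforked_walk (w := [:: b])) (ux); apply: (infinite_child q_gt1).
  by case: ux.
move=> /infinite_setN0[d /(Sigma_in_I q_gt1) Inb].
by apply: nsx; apply/(in_switchP q_gt1); case: b {sw} Ib Inb.
Qed.

Lemma unforked_reaches_state x : unforked q x ->
  exists j : nat, unforked q (1 + c * r ^+ j).
Proof.
move=> /unforked_meets_switch[y uy /andP[y1 y2]].
have yE : q * y - 1 = c * ((q * y - 1) / c).
  by rewrite mulrCA mulfV ?mulr1 // gt_eqF.
have [|a [[->|[j ->]] ua _]] := unforked_switch uy yE; last by exists j.
  rewrite divr_ge0 ?subr_ge0 ?(ltW c_gt0) //= ler_pdivrMr // [N * c]mulrC -L1E.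
  by rewrite lerB.
(* The case [a = 0] is the point 1: one forced digit leads to a second switch point, whose offset
   [M] is strictly between 0 and [N], so a state follows. *)
have zE : q * (q * (1 + c * 0) - 1) - 1 = c * M.
  by rewrite first_step_eq mulr0 addr0.
have uz := unforked_right q_gt1 ua (first_step_gt (lexx 0)).
have [|j uj _] := unforked_switch_pos uz zE; last by exists j.
by rewrite M_gt0 -subr_gt0 N_M; move: poly3_neg; lra.
Qed.

Lemma aleph0_below_q3 x : Sigma_ q x #= [set: nat] ->
  poly1 q = 0 \/ poly2 q = 0.
Proof.
move=> xN.
have cx : countable (Sigma_ q x) by rewrite (eq_countable xN).
have ix : infinite_set (Sigma_ q x).
  by move=> fx; apply: infinite_nat; rewrite -(eq_finite_set xN).
have [w uw] := exists_unforked q_gt1 ix cx.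
have [j uj] := unforked_reaches_state uw.
have [p1|p1|] := ltgtP (poly1 q) 0; last by left.
  exfalso; exact: (no_state_below_q1 q_gt85 q_lt qe_gt0 poly3_neg
    state_transition p1 uj).
have [|p2] := eqVneq (poly2 q) 0; first by right.
exfalso; exact: (no_state_above_q1 q_gt85 q_lt qe_gt0 poly3_neg
  state_transition p1 p2 uj).
Qed.

End Transitions.

(** * Points with countably many expansions *)

(* Apart from the limit of the iterates of [phi], every element of [A] is some
   [iter n phi e]. *)
Lemma contraction_aleph0 (A : set (nat -> bool)) phi e :
  A e -> (forall d, A d -> A (phi d)) -> injective phi ->
  (forall d, A d -> d = e \/ exists2 d', A d' & d = phi d') ->
  (forall d, e <> phi d) ->
  (forall n d d', (forall i, (i < n)%N -> d i = d' i) ->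
     forall i, (i < n.+1)%N -> phi d i = phi d' i) ->
  A #= [set: nat].
Proof.
move=> Ae Aphi phi_inj Asplit e_phi phi_contr.
have iterA n : A (iter n phi e) by elim: n => // n; exact: Aphi.
apply: eq_card_nat.
  pose B := [set d | forall n, exists d', d = iter n phi d'].
  (* Piece 0 collects the elements lying in the image of every iterate. It has at most one element,
     since [n] applications of [phi] determine the first [n] digits. *)
  pose F n := if n is m.+1 then [set iter m phi e] else A `&` B.
  have -> : A = \bigcup_n F n.
    apply/seteqP; split => [d Ad|d [[|n] _] /=]; last 2 first.
    - by case.
    - by move=> ->.
    have [[n ->]|nd] := pselect (exists n, d = iter n phi e).
      by exists n.+1.
    exists 0%N => //; split => // n.
    suff [d' _ ->] : exists2 d', A d' & d = iter n phi d' by exists d'.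
    elim: n => [|n [d' Ad' E]]; first by exists d.
    have [e'|[d'' Ad'' E'']] := Asplit _ Ad'.
      by case: nd; exists n; rewrite E e'.
    by exists d'' => //; rewrite iterSr -E''.
  apply: bigcup_countable => [|[|n] _]; [exact: card_lexx| |exact: countable1].
  rewrite /F; have [->|/set0P[d [_ Bd]]] := eqVneq (A `&` B) set0.
    exact: countable0.
  apply: (@sub_countable _ _ _ [set d]); last exact: countable1.
  apply: subset_card_le => d' [_ Bd'] /=; apply/funext => i.
  have [x ->] := Bd i.+1; have [y ->] := Bd' i.+1.
  have agree n j : (j < n)%N -> iter n phi y j = iter n phi x j.
    by elim: n j => // n IH j jn /=; apply: phi_contr jn.
  exact: agree.
move=> fA; apply: infinite_nat.
have iter_inj : injective (fun n => iter n phi e).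
  have lt_neq m n : (m < n)%N -> iter m phi e <> iter n phi e.
    elim: m n => [|m IH] [|n] // mn; first exact: e_phi.
    by move=> /phi_inj; exact: IH.
  by move=> m n E; have [/lt_neq|/lt_neq/(_ (esym E))|] := ltngtP m n.
apply: sub_finite_set (finite_preimage _ fA) => [n _|]; first exact: iterA.
by move=> m n _ _; exact: iter_inj.
Qed.

Lemma foldr_scons_inj v : injective (fun d => foldr scons d v).
Proof. by elim: v => // b v IH d d' /scons_inj/IH. Qed.

Lemma foldr_scons_agree v n d d' : (forall i, (i < n)%N -> d i = d' i) ->
  forall i, (i < n)%N -> foldr scons d v i = foldr scons d' v i.
Proof.
elim: v n => // b v IH n dd' [|i] //= /ltnW /= ni; exact: (IH n).
Qed.

Section Loops.
Variables (R : realType) (q : R).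
Hypothesis q_gt1 : 1 < q.

(** At the end of the forced path one branch has a single expansion and the other is a copy of [s]
    through [psi], which will be the identity or the exchange of the digits. Going round the loop is
    the contraction. *)
Lemma loop_aleph0 s w (b : bool) (psi : (nat -> bool) -> nat -> bool) :
  forced q s w ->
  (forall d, Sigma_ q (q * w - b%:R) (psi d) <-> Sigma_ q s d) ->
  involutive psi ->
  (forall n d d', (forall i, (i < n)%N -> d i = d' i) ->
     forall i, (i < n)%N -> psi d i = psi d' i) ->
  switch_free q (q * w - (~~ b)%:R) -> Sigma_ q (q * w - (~~ b)%:R) !=set0 ->
  Sigma_ q s #= [set: nat].
Proof.
move=> /(Sigma_forced q_gt1)[v [wv sv]] psiP psiK psi_agree.
move=> /(switch_free_Sigma q_gt1) sub1 [e0 we0].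
apply: (@contraction_aleph0 _ (fun d => foldr scons (scons b (psi d)) v)
    (foldr scons (scons (~~ b) e0) v)).
- exact/wv/(Sigma_scons q_gt1).
- by move=> d sd; apply/wv/(Sigma_scons q_gt1)/psiP.
- move=> d d' /foldr_scons_inj/scons_inj; exact: (inv_inj psiK).
- move=> _ /sv[d wd ->]; move: wd; rewrite -(scons_eta d).
  have [<-|nb] := eqVneq b (d 0%N) => /(Sigma_scons q_gt1) wd.
    right; exists (psi (fun n => d n.+1)); last by rewrite psiK.
    by apply/psiP; rewrite psiK.
  left; have E : d 0%N = ~~ b by move: nb; case: (b) (d 0%N) => [] [].
  by rewrite E in wd *; rewrite (sub1 _ _ wd we0).
- by move=> d /foldr_scons_inj/(congr1 (@^~ 0%N)) /=; case: (b).
- move=> n d d' dd'; apply: foldr_scons_agree => -[|i] //=.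
  by rewrite ltnS; exact: psi_agree dd' i.
Qed.

End Loops.

(** * States that return to themselves *)

Section Existence.
Variables (R : realType) (q : R).
Hypotheses (q_gt85 : 8/5 < q) (q_lt : q < 1681/1000) (qe_gt0 : 0 < qe q).

Let r := q^-1.
Let L := 1 / (q - 1).
Let N := state_total q.
Let c := unit_state q.

Let q_gt1 : 1 < q. Proof. by move: q_gt85; lra. Qed.
Let q_lt2 : q < 2. Proof. by move: q_lt; lra. Qed.
Let q_gt0 : 0 < q. Proof. by move: q_gt85; lra. Qed.

Let L1E : L - 1 = c * N. Proof. exact: total_eq. Qed.

Let c_gt0 : 0 < c.
Proof. by rewrite divr_gt0 // mulr_gt0 // subr_gt0 exprn_egt1. Qed.

Let state_in_I j : in_I q (c * r ^+ j).
Proof.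
have r0 : 0 <= r by rewrite invr_ge0 ltW.
rewrite /in_I -/L mulr_ge0 ?exprn_ge0 ?(ltW c_gt0) //=.
rewrite -(subrK 1 L) L1E (le_trans (y := c)) //.
  by rewrite ler_piMr ?(ltW c_gt0) // exprn_ile1 // invf_le1 // ltW.
have cN : c <= c * N.
  rewrite ler_peMr ?(ltW c_gt0) //.
  have : 7/5 < N by apply: total_gt; rewrite !ltW.
  by lra.
by move: cN; lra.
Qed.

(** The digit 0 leads back to the state and the digit 1 to its switch-free part. *)
Lemma fixed_state_aleph0 j : state_value q j = r ^+ j ->
  Sigma_ q (1 + c * r ^+ j) #= [set: nat].
Proof.
move=> Fj; have [w jw wE] := state_path q_gt85 qe_gt0 j.
rewrite Fj -/c in wE.
apply: (@loop_aleph0 _ _ q_gt1 _ w false id) => //=.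
- by move=> d; rewrite subr0 -wE [1 + _]addrC subrK.
- by rewrite wE; apply: switch_free_state.
- by rewrite wE; apply: (Sigma_nonempty q_gt1 q_lt2); exact: state_in_I.
Qed.

(** The digit 1 leads to the reflected state and the digit 0 to the reflection of its switch-free
    part. *)
Lemma reflected_state_aleph0 j : N - state_value q j = r ^+ j ->
  Sigma_ q (1 + c * r ^+ j) #= [set: nat].
Proof.
move=> Fj; have [w jw wE] := state_path q_gt85 qe_gt0 j.
have E1 : q * w - 1 = L - (1 + c * r ^+ j).
  by rewrite wE -/c -Fj mulrBr -L1E; ring.
have E0 : q * w - 0 = L - c * r ^+ j by rewrite subr0 -[LHS](subrK 1) E1; ring.
apply: (@loop_aleph0 _ _ q_gt1 _ w true (fun d n => ~~ d n)) => //=.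
- move=> d; rewrite E1; split => /(Sigma_reflect q_gt1); rewrite -/L.
    rewrite subKr; congr (Sigma_ _ _ _); apply/funext => n.
    by rewrite negbK.
  by [].
- by move=> d; apply/funext => n; rewrite negbK.
- by move=> n d d' dd' i /dd' ->.
- by rewrite E0; apply: (switch_free_reflect q_gt1); apply: switch_free_state.
- rewrite E0; apply: (Sigma_nonempty q_gt1 q_lt2); rewrite /in_I -/L.
  have /andP[h0 h1] := state_in_I j.
  by rewrite subr_ge0 h1 /= gerBl.
Qed.

Lemma aleph0_mem x :
  golden_ratio <= q -> Sigma_ q x #= [set: nat] -> B_aleph0 q.
Proof.
move=> qG xN; split; first by rewrite qG q_lt2.
exists x => //; rewrite inE /I_ /= in_itv /=.
have [d /(Sigma_in_I q_gt1)] : Sigma_ q x !=set0; last by [].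
apply: infinite_setN0 => fx; apply: infinite_nat.
by rewrite -(eq_finite_set xN).
Qed.

End Existence.

(** * Location of the three roots and of the golden ratio *)

Section Roots.
Variable R : realType.
Implicit Types (a q x : R).

(** With a numerical [a], these inequalities are linear in the powers of [q], which [lra] then
    treats as unknowns. *)
Lemma expS_le a q : 0 < q -> q <= a -> forall n, q ^+ n.+1 <= a * q ^+ n.
Proof. by move=> q0 qa n; rewrite exprS ler_wpM2r // exprn_ge0 // ltW. Qed.

Lemma expS_ge a q : 0 < q -> a <= q -> forall n, a * q ^+ n <= q ^+ n.+1.
Proof. by move=> q0 qa n; rewrite exprS ler_wpM2r // exprn_ge0 // ltW. Qed.

Lemma poly1_root_itv q : 0 < q -> poly1 q = 0 -> 81/50 < q < 83/50.
Proof.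
move=> q0 qE; apply/andP; split; rewrite ltNge; apply/negP => h.
  have H := expS_le q0 h; move: (H 1%N) (H 2%N) (H 3%N) (H 4%N) (H 5%N) qE.
  by rewrite /poly1; lra.
have H := expS_ge q0 h; move: (H 1%N) (H 2%N) (H 3%N) (H 4%N) (H 5%N) qE.
by rewrite /poly1; lra.
Qed.

Lemma poly2_root_itv q : 0 < q -> poly2 q = 0 -> 81/50 < q < 83/50.
Proof.
move=> q0 qE; apply/andP; split; rewrite ltNge; apply/negP => h.
  have H := expS_le q0 h; move: (H 1%N) (H 2%N) (H 3%N) (H 4%N) (H 5%N) qE.
  by rewrite /poly2; lra.
have H := expS_ge q0 h; move: (H 1%N) (H 2%N) (H 3%N) (H 4%N) (H 5%N) qE.
by rewrite /poly2; lra.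
Qed.

Lemma poly3_root_itv q : 1 < q < 2 -> poly3 q = 0 -> 83/50 < q < 1681/1000.
Proof.
move=> /andP[q1 q2] qE; apply/andP; split; last first.
  rewrite ltNge; apply/negP => h.
  by have := @poly3_gt0 _ q; rewrite qE ltxx h (ltW q2) => /(_ isT).
have q0 : 0 < q by lra.
have q32 : 3/2 < q.
  rewrite ltNge; apply/negP => h; have H := expS_le q0 h.
  move: (H 3%N) (H 4%N) qE (exprn_gt0 3 q0).
  by rewrite /poly3; lra.
rewrite ltNge; apply/negP => h; have H := expS_le q0 h.
by move: (H 1%N) (H 2%N) (H 3%N) (H 4%N) qE; rewrite /poly3; lra.
Qed.

(** Expanded at 8/5, all nonconstant coefficients of [poly3] are positive. *)
Lemma poly3_incr q x : 8/5 < q -> q < x -> poly3 q < poly3 x.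
Proof.
move=> q85 qx; have H n : (q - 8/5) ^+ n.+1 < (x - 8/5) ^+ n.+1.
  by rewrite ltrXn2r //; lra.
by move: (H 1%N) (H 2%N) (H 3%N) (H 4%N) qx; rewrite /poly3; lra.
Qed.

Lemma golden_ratio_lt q : 8/5 < q -> (golden_ratio < q) = (0 < qe q).
Proof.
move=> q85; rewrite /golden_ratio ltr_pdivrMr //.
have s0 := sqrtr_ge0 (5 : R); have s5 : Num.sqrt 5 ^+ 2 = 5 :> R.
  by rewrite sqr_sqrtr.
apply/idP/idP => h; rewrite ltNge; apply/negP; move: h; rewrite /qe => h h'.
  have : Num.sqrt 5 ^+ 2 < (q * 2 - 1) ^+ 2 by rewrite ltrXn2r //; lra.
  by rewrite s5; lra.
have : (q * 2 - 1) ^+ 2 <= Num.sqrt 5 ^+ 2 by rewrite lerXn2r ?nnegrE //; lra.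
by rewrite s5; lra.
Qed.

Lemma golden_ratio_gt : 8/5 < golden_ratio :> R.
Proof.
rewrite /golden_ratio ltr_pdivlMr // -ltrBlDl.
rewrite -[ltLHS]ger0_norm; last by lra.
by rewrite -sqrtr_sqr ltr_sqrt; lra.
Qed.

End Roots.

Theorem theorem1p2 (R : realType) (q1 q2 q3 : R)
  (q1_gt0 : 0 < q1)
  (q1_root : q1 ^+ 6 - q1 ^+ 4 - q1 ^+ 3 - 2 * q1 ^+ 2 - q1 - 1 = 0)
  (q2_gt0 : 0 < q2)
  (q2_root : q2 ^+ 6 - 2 * q2 ^+ 4 - q2 ^+ 3 - 1 = 0)
  (q3_itv : 1 < q3 < 2)
  (q3_root : q3 ^+ 5 - q3 ^+ 4 - q3 ^+ 3 - q3 + 1 = 0) :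
  B_aleph0 `&` `]golden_ratio, q3] = [set q1; q2; q3].
Proof.
have /andP[q1a q1b] := poly1_root_itv q1_gt0 q1_root.
have /andP[q2a q2b] := poly2_root_itv q2_gt0 q2_root.
have /andP[q3a q3b] := poly3_root_itv q3_itv q3_root.
have qe_pos (q : R) : 81/50 < q -> 0 < qe q.
  move=> h; have : 0 < (q - 81/50) * (q - 81/50) + (q - 81/50).
    by rewrite ltr_wpDl ?mulr_ge0 //; lra.
  by rewrite /qe; lra.
have G_lt (q : R) : 81/50 < q -> golden_ratio < q.
  by move=> h; rewrite golden_ratio_lt ?qe_pos //; lra.
apply/seteqP; split => [q [[_ [x _ xN]]]|q].
  rewrite /= in_itv /= => /andP[Gq qq3].
  have q85 := lt_trans (golden_ratio_gt R) Gq.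
  have e0 : 0 < qe q by rewrite -golden_ratio_lt.
  have [->|nq3] := eqVneq q q3; first by right.
  have lt3 : q < q3 by rewrite lt_neqAle nq3.
  have p3 : poly3 q < 0 by rewrite -q3_root; exact: poly3_incr.
  have q0 : 0 < q by lra.
  left; have [p|p] := aleph0_below_q3 q85 (lt_trans lt3 q3b) e0 p3 xN.
    left; have [y [_ yP]] := q1_exists_unique R.
    by rewrite /= -(yP q1) // -(yP q).
  right; have [y [_ yP]] := q2_exists_unique R.
  by rewrite /= -(yP q2) // -(yP q).
have mem (q' : R) j : 81/50 < q' -> q' < 1681/1000 -> q' <= q3 ->
    (state_value q' j = q'^-1 ^+ j \/
     state_total q' - state_value q' j = q'^-1 ^+ j) ->
    (B_aleph0 `&` `]golden_ratio, q3]) q'.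
  move=> h0 h1 h2 E; have h85 : 8/5 < q' by lra.
  split; last by rewrite /= in_itv /= G_lt.
  have e0 := qe_pos _ h0.
  apply: (aleph0_mem h85 h1 (x := 1 + unit_state q' * q'^-1 ^+ j)).
    exact/ltW/G_lt.
  by case: E; [exact: fixed_state_aleph0|exact: reflected_state_aleph0].
move=> [[|]|] /= ->.
(* At [q1], state 2 returns to its own reflection: [- poly3 q1] equals [q1^-1 ^+ 2]. *)
- apply: (mem _ 2%N); [exact: q1a|lra|lra|right].
  rewrite /= expr0 /state_total /qe; apply: (mulfI (x := q1 ^+ 2)).
    by rewrite expf_neq0 // gt_eqF.
  rewrite exprVn mulfV ?expf_neq0 ?gt_eqF //.
  apply/eqP; rewrite -subr_eq0; apply/eqP.
  transitivity (- ((q1 - 1) * poly1 q1)); first by rewrite /poly1; ring.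
  by rewrite /poly1 q1_root mulr0 oppr0.
(* At [q2], state 0 returns to its own reflection. *)
- apply: (mem _ 0%N); [exact: q2a|lra|lra|right].
  rewrite expr0 /state_total /= /qe; apply/eqP; rewrite -subr_eq0; apply/eqP.
  transitivity ((1 - q2) * poly2 q2); first by rewrite /poly2; ring.
  by rewrite /poly2 q2_root mulr0.
(* At [q3], state 0 returns to itself directly. *)
- apply: (mem _ 0%N); [lra|exact: q3b|exact: lexx|left].
  rewrite expr0 /= /qe; apply/eqP; rewrite -subr_eq0; apply/eqP.
  transitivity (poly3 q3 * (q3 ^+ 2 - 1)); first by rewrite /poly3; ring.
  by rewrite /poly3 q3_root mul0r.
Qed.
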